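(* Let $t,s$ be nonnegative integers and let $m\ge 2$ be an integer. Suppose that one of the following holds. (i) The pairs $(A_i,B_i)$, $1\le i\le m$, are pairs of finite sets satisfying $|A_i\cap B_i|\le t$ for all $i$ and $|A_i\cap B_j|>t+s$ for all $i\ne j$; put $a_i=|A_i|$ and $b_i=|B_i|$. (ii) The pairs $(A_i,B_i)$, $1\le i\le m$, are pairs of subspaces of a finite-dimensional vector space over an arbitrary field satisfying $\dim(A_i\cap B_i)\le t$ for all $i$ and $\dim(A_i\cap B_j)>t+s$ for all $i\ne j$; put $a_i=\dim A_i$ and $b_i=\dim B_i$. Then, in either case, $$\sum_{i=1}^{m}\frac{\binom{b_i-t+s}{s}}{\binom{a_i+b_i-2t}{a_i-t}}\le 1.$$
   Context: Here $\binom{a}{b}$ denotes the usual binomial coefficient. The cross-intersection conditions with $m\ge2$ force $a_i,b_i\ge t+s+1$, so all binomial coefficients have nonnegative integer entries. *)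

(* Defs.v *)
From HB Require Import structures.
From mathcomp Require Export all_boot all_order all_algebra.
From mathcomp Require Export finmap.

Set Implicit Arguments.
Unset Strict Implicit.
Unset Printing Implicit Defensive.

Import GRing.Theory Num.Theory.
Local Open Scope ring_scope.

(* The truncated subtractions are exact wherever this is used: as soon as there
   are two pairs, the cross-intersection conditions force t < a and t < b. *)
Definition pair_weight (t s a b : nat) : rat :=
  'C(b - t + s, s)%:R / 'C(a + b - 2 * t, a - t)%:R.

(* Main.v *)
Require Import Defs.
From mathcomp Require Import all_boot all_order all_algebra finmap.
From HB Require Import structures.
From mathcomp Require Import zify ring lra.

Set Implicit Arguments.
Unset Strict Implicit.
Unset Printing Implicit Defensive.

Import Order.TTheory GRing.Theory Num.Theory.
Local Open Scope fset_scope.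
Local Open Scope ring_scope.

(** Finite sets become coordinate subspaces, and the field is enlarged to an
    infinite one.  Intersecting everything with a generic hyperplane lowers t
    by one.  When t = 0, fix a basis (v_p) of each A and replace (A, B) by all
    the pairs (<v_p | p not in S>, B + <v_p | p in S>) with |S| = s; this reduces the
    statement to Bollobas' inequality sum 1 / C(a_i + b_i, a_i) <= 1 for subspaces
    with A_i /\ B_i = 0 and A_i /\ B_j <> 0 for distinct i, j.

    For the latter, let alpha_i, beta_j be the exterior products of bases and let J
    be the ideal of all w with w ^ beta_j = 0 for every j.  In a set model, J_k would
    be the k-sets meeting every B_j, and counting the pairs (T, x) with T not in J
    and T + x in J gives
      (k+1) dim J_(k+1) - (n-k) dim J_k >= sum_i b_i C(n - a_i - b_i, k - a_i).
    This local LYM inequality survives in the exterior algebra.  Take a basis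
    e_0, e_1, ... generic with respect to the A_i + B_i, and write
    w = w' + e_0 ^ w''.  The dimension of J_(k+1) is the sum of the dimensions of
    its image under w -> w' and of the fibre {u | e_0 ^ u in J_(k+1)}, both of
    which live in one dimension less and satisfy the same hypotheses, so that
    induction on n applies.  Dividing by (n-k) C(n, k) and summing over k
    telescopes to the inequality. *)

(** * The exterior algebra of a coordinate space *)

(* A row vector (w', w'') of length [ext_dim n.+1] stands for w' + e_0 ^ w'', where
   w' and w'' involve only e_1, ..., e_n, renumbered from 0.  Operators act on the
   right: [w *m ext_gen n x] is e_x ^ w, and it is 0 when n <= x. *)
Fixpoint ext_dim n := if n is n'.+1 then (ext_dim n' + ext_dim n')%N else 1%N.

Section ExteriorAlgebra.
Variable F : fieldType.

Notation Ext n := 'rV[F]_(ext_dim n).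
Notation Op n := 'M[F]_(ext_dim n).

Fixpoint ext_gen n : nat -> Op n :=
  match n return nat -> Op n with
  | 0 => fun _ => 0
  | n'.+1 => fun x =>
      match x with
      | 0 => block_mx 0 1%:M 0 0
      | x'.+1 => block_mx (ext_gen n' x') 0 0 (- ext_gen n' x')
      end
  end.

(* Contraction by the coordinate form dual to e_x. *)
Fixpoint int_gen n : nat -> Op n :=
  match n return nat -> Op n with
  | 0 => fun _ => 0
  | n'.+1 => fun x =>
      match x with
      | 0 => block_mx 0 0 1%:M 0
      | x'.+1 => block_mx (int_gen n' x') 0 0 (- int_gen n' x')
      end
  end.

(** The unit 1 of the exterior algebra; the operators turn it into products of vectors. *)
Fixpoint ext_vac n : Ext n :=
  match n return Ext n with
  | 0 => 1%:M
  | n'.+1 => row_mx (ext_vac n') 0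
  end.

(* The projection onto the component of degree k. *)
Fixpoint ext_deg n : nat -> Op n :=
  match n return nat -> Op n with
  | 0 => fun k => (k == 0%N)%:R%:M
  | n'.+1 => fun k =>
      block_mx (ext_deg n' k) 0 0 (if k is k'.+1 then ext_deg n' k' else 0)
  end.

(* [w *m ext_flag n r] is e_0 ^ ... ^ e_(r-1) ^ w. *)
Fixpoint ext_flag n : nat -> Op n :=
  match n return nat -> Op n with
  | 0 => fun r => (r == 0%N)%:R%:M
  | n'.+1 => fun r =>
      match r with
      | 0 => 1%:M
      | r'.+1 => block_mx 0 (ext_flag n' r') 0 0
      end
  end.

Lemma ext_genC n x y :
  ext_gen n x *m ext_gen n y = - (ext_gen n y *m ext_gen n x).
Proof.
elim: n x y => [|n IH] [|x] [|y]; rewrite /= ?mul0mx ?oppr0 //.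
- by rewrite !mulmx_block !(mulmx0, mul0mx, addr0) opp_block_mx oppr0.
- by rewrite !mulmx_block !(mulmx0, mul0mx, mulmx1, mul1mx, addr0, add0r) opp_block_mx oppr0.
- by rewrite !mulmx_block !(mulmx0, mul0mx, mulmx1, mul1mx, addr0, add0r) opp_block_mx oppr0 opprK.
by rewrite !mulmx_block !(mulmx0, mul0mx, addr0, add0r) opp_block_mx oppr0 !mulNmx !mulmxN !opprK (IH x y).
Qed.

Lemma ext_gen_sq n x : ext_gen n x *m ext_gen n x = 0.
Proof.
elim: n x => [|n IH] [|x]; rewrite /= ?mul0mx //.
- by rewrite !mulmx_block !(mulmx0, mul0mx, addr0) block_mx0.
by rewrite !mulmx_block !(mulmx0, mul0mx, addr0, add0r) mulNmx mulmxN opprK IH block_mx0.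
Qed.

(** The canonical anticommutation relation. For x >= n both operators vanish, so the case x = y
    would fail there. *)
Lemma ext_int_gen n x y : (x < n)%N ->
  ext_gen n x *m int_gen n y + int_gen n y *m ext_gen n x = (x == y)%:R%:M.
Proof.
elim: n x y => [|n IH] [|x] [|y] lxn //=.
- rewrite !mulmx_block !(mulmx0, mul0mx, mulmx1, addr0, add0r) add_block_mx.
  by rewrite !(addr0, add0r) -scalar_mx_block.
- rewrite !mulmx_block !(mulmx0, mul0mx, mulmx1, mul1mx, addr0, add0r) add_block_mx.
  by rewrite !(addr0, add0r) addNr block_mx0 -scalemx1 scale0r.
- rewrite !mulmx_block !(mulmx0, mul0mx, mulmx1, mul1mx, addr0, add0r) add_block_mx.
  by rewrite !(addr0, add0r) addNr block_mx0 -scalemx1 scale0r.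
rewrite !mulmx_block !(mulmx0, mul0mx, mulmx1, mul1mx, addr0, add0r) add_block_mx.
by rewrite !(addr0, add0r) !mulNmx !mulmxN !opprK IH // eqSS -scalar_mx_block.
Qed.

Lemma int_gen_vac n x : ext_vac n *m int_gen n x = 0.
Proof.
elim: n x => [|n IH] [|x]; rewrite /= ?mulmx0 // mul_row_block !(mulmx0, mul0mx, addr0) ?IH row_mx0 //.
Qed.

Lemma ext_vac_deg n : (ext_vac n <= ext_deg n 0)%MS.
Proof.
elim: n => [|n IH] /=; first exact: submx1.
have /submxP [D ->] := IH.
by apply/submxP; exists (row_mx D 0); rewrite mul_row_block !(mulmx0, mul0mx, addr0).
Qed.

Lemma ext_deg_gen n k x : (ext_deg n k *m ext_gen n x <= ext_deg n k.+1)%MS.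
Proof.
elim: n k x => [|n IH] k [|x] /=; rewrite ?mulmx0 ?sub0mx //.
- rewrite mulmx_block !(mulmx0, mul0mx, mulmx1, addr0, add0r).
  apply/submxP; exists (block_mx 0 1%:M 0 0).
  by rewrite mulmx_block !(mulmx0, mul0mx, mul1mx, addr0, add0r).
rewrite mulmx_block !(mulmx0, mul0mx, mulmx1, addr0, add0r).
have /submxP [D ->] := IH k x.
have [E ->] : exists E, (if k is k'.+1 then ext_deg n k' else 0) *m - ext_gen n x = E *m ext_deg n k.
  case: k {D} => [|k]; first by exists 0; rewrite !mul0mx.
  by have /submxP [E H] := IH k x; exists (- E); rewrite mulmxN H mulNmx.
apply/submxP; exists (block_mx D 0 0 E).
by rewrite mulmx_block !(mulmx0, mul0mx, mulmx1, addr0, add0r).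
Qed.

Lemma ext_deg_large n k : (n < k)%N -> ext_deg n k = 0.
Proof.
elim: n k => [|n IH] [|k] //= lnk; first by rewrite -scalemx1 scale0r.
by rewrite !IH ?block_mx0 // ltnW.
Qed.

Lemma rank_ext_deg_top n : (\rank (ext_deg n n) <= 1)%N.
Proof.
elim: n => [|n IH] /=; first exact: rank_leq_row.
rewrite ext_deg_large //.
have -> : block_mx 0 0 0 (ext_deg n n) = col_mx (0 : Op n) 1%:M *m (ext_deg n n *m row_mx (0 : Op n) 1%:M).
  by rewrite mul_mx_row mul_col_row !(mulmx0, mul0mx, mulmx1, mul1mx).
apply: leq_trans (mxrankM_maxr _ _) _.
exact: leq_trans (mxrankM_maxl _ _) IH.
Qed.

Lemma ext_flagE n r : (r < n)%N ->
  ext_flag n r.+1 = ext_gen n r *m ext_flag n r.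
Proof.
elim: n r => [|n IH] [|r] lrn //=.
  by rewrite mulmx1; case: (n) => [|p].
rewrite IH // mulmx_block !(mulmx0, mul0mx, addr0) //.
Qed.

End ExteriorAlgebra.

(** * Independence modulo a subspace *)

Lemma rank_add_indep_seq (F : fieldType) (I : eqType) (N : nat)
    (u : I -> 'rV[F]_N) (s : seq I) m (M : 'M[F]_(m, N)) :
  uniq s ->
  (forall c : I -> F, ((\sum_(i <- s) c i *: u i)%R <= M)%MS -> {in s, forall i, c i = 0}) ->
  (\rank M + size s <= \rank (M + \sum_(i <- s) <<u i>>)%MS)%N.
Proof.
elim: s m M => [|i s IH] m M /=.
  by move=> _ _; rewrite big_nil addn0 mxrankS ?addsmxSl.
case/andP=> nis us ind.
have H1 : (\rank M < \rank (M + <<u i>>)%MS)%N.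
  rewrite ltn_neqAle mxrankS ?addsmxSl // andbT.
  apply/negP => /eqP H.
  have : (u i <= M)%MS.
    have : (M + <<u i>> <= M)%MS.
      by have [_ <-] := mxrank_leqif_sup (addsmxSl M <<u i>>%MS); rewrite H.
    by apply: submx_trans; rewrite (submx_trans _ (addsmxSr _ _)) ?genmxE.
  move=> uM.
  have /(_ _ i (mem_head _ _)) : _ -> {in i :: s, forall j, (j == i)%:R = 0 :> F} := ind (fun j => (j == i)%:R).
  rewrite eqxx => H2; suff : (1 : F) = 0 by move/eqP; rewrite oner_eq0.
  apply: H2; rewrite big_cons eqxx scale1r big_seq big1 ?addr0 // => j js.
  by case: eqP js nis => [->->|_ _ _]; rewrite ?scale0r.
have H2 := IH _ (M + <<u i>>)%MS us _.
rewrite big_cons addsmxA -addSnnS; apply: leq_trans (H2 _); first by rewrite leq_add2r.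
move=> c /sub_addsmxP [[w1 w2] /= E].
have [l El] : exists l, w2 *m <<u i>>%MS = l *: u i.
  have /submxP [D ->] : (w2 *m <<u i>> <= u i)%MS by rewrite (submx_trans (submxMl _ _)) ?genmxE.
  by exists (D 0 0); rewrite {1}[D]mx11_scalar mul_scalar_mx.
(* A relation modulo M + <u i> becomes one modulo M once the multiple l of [u i] is moved to the
   left. *)
pose c' j := if j == i then - l else c j.
have Ec : {in s, forall j, c' j = c j}.
  by move=> j js; rewrite /c'; case: eqP js nis => [->->|].
move=> j js; rewrite -Ec //.
apply: (ind c'); rewrite ?inE ?js ?orbT //.
rewrite big_cons {1}/c' eqxx (eq_big_seq (fun j => c j *: u j)); last by move=> k ks; rewrite Ec.
by rewrite E El scaleNr addrCA addNr addr0 submxMl.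
Qed.

Lemma rank_add_indep (F : fieldType) (I : finType) (N : nat)
    (P : pred I) (u : I -> 'rV[F]_N) m (M : 'M[F]_(m, N)) :
  (forall c : I -> F, ((\sum_(i | P i) c i *: u i)%R <= M)%MS -> forall i, P i -> c i = 0) ->
  (\rank M + \sum_(i | P i) 1 <= \rank (M + \sum_(i | P i) <<u i>>)%MS)%N.
Proof.
move=> ind.
rewrite sum1dep_card cardsE -sum1_card -[in X in (X <= _)%N]big_filter -[in X in (_ <= X)%N]big_filter sum1_size.
apply: rank_add_indep_seq; first by rewrite filter_uniq ?index_enum_uniq.
move=> c H i; rewrite mem_filter => /andP [Pi _].
by apply: (ind c) => //; rewrite -big_filter.
Qed.

(** * The local LYM inequality *)

Section SplitSubspace.
Variables (F : fieldType) (p q : nat).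

(** For p = q = [ext_dim n] these are the image of A under w -> w' and the fibre {u | e_0 ^ u in
    A}. *)
Definition fst_image m (A : 'M[F]_(m, p + q)) : 'M_p := <<lsubmx A>>%MS.
Definition snd_fiber m (A : 'M[F]_(m, p + q)) : 'M_q :=
  <<rsubmx (A :&: row_mx (0 : 'M_(q, p)) 1%:M)>>%MS.

Lemma fst_image_mx m k (w : 'M[F]_(k, p + q)) (A : 'M[F]_(m, p + q)) :
  (w <= A)%MS -> (lsubmx w <= fst_image A)%MS.
Proof. by rewrite genmxE => /submxP [D ->]; rewrite -mulmx_lsub submxMl. Qed.

Lemma fst_imageP m k (u : 'M[F]_(k, p)) (A : 'M[F]_(m, p + q)) :
  (u <= fst_image A)%MS -> exists2 w : 'M_(k, p + q), (w <= A)%MS & u = lsubmx w.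
Proof.
by rewrite genmxE => /submxP [D ->]; exists (D *m A); rewrite ?submxMl ?mulmx_lsub.
Qed.

Lemma sub_snd_fiber m k (u : 'M[F]_(k, q)) (A : 'M[F]_(m, p + q)) :
  (u <= snd_fiber A)%MS = (row_mx (0 : 'M_(k, p)) u <= A)%MS.
Proof.
rewrite genmxE; apply/idP/idP => [/submxP [D ->]|H].
  set K := (A :&: _)%MS.
  have /submxP [E EK] : (K <= row_mx (0 : 'M_(q, p)) 1%:M)%MS by exact: capmxSr.
  have -> : row_mx 0 (D *m rsubmx K) = D *m K.
    by rewrite EK mul_mx_row row_mxKr mul_mx_row !mulmx0 !mulmx1.
  by apply: submx_trans (submxMl _ _) (capmxSl _ _).
have : (row_mx (0 : 'M_(k, p)) u <= A :&: row_mx (0 : 'M_(q, p)) 1%:M)%MS.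
  rewrite sub_capmx H; apply/submxP; exists u.
  by rewrite mul_mx_row mulmx0 mulmx1.
by case/submxP => D E; apply/submxP; exists D; rewrite mulmx_rsub -E row_mxKr.
Qed.

(** Rank-nullity for the projection to the first block: its kernel in A consists of the vectors (0,
    u) of A. *)
Lemma rank_fst_snd m (A : 'M[F]_(m, p + q)) :
  \rank A = (\rank (fst_image A) + \rank (snd_fiber A))%N.
Proof.
rewrite !genmxE -(mxrank_mul_ker A (col_mx 1%:M 0 : 'M_(p + q, p))).
have lsubE k (B : 'M[F]_(k, p + q)) : B *m (col_mx 1%:M 0 : 'M_(p + q, p)) = lsubmx B.
  by rewrite -{1}[B]hsubmxK mul_row_col mulmx1 mulmx0 addr0.
rewrite lsubE; congr addn.
set K := (A :&: row_mx _ _)%MS.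
have /submxP [E EK] : (K <= row_mx (0 : 'M_(q, p)) 1%:M)%MS by exact: capmxSr.
have -> : \rank (rsubmx K) = \rank K.
  have EK' : K = rsubmx K *m row_mx (0 : 'M_(q, p)) 1%:M.
    by rewrite EK mul_mx_row row_mxKr !mul_mx_row !mulmx0 !mulmx1.
  rewrite {2}EK' mxrankMfree //; apply/row_freeP; exists (col_mx 0 1%:M).
  by rewrite mul_row_col mul0mx mulmx1 add0r.
apply: eqmx_rank; apply/eqmxP; apply: cap_eqmx (eqmx_refl A) _.
apply/eqmxP/andP; split.
  set Q := kermx _.
  have HQ : lsubmx Q = 0 by rewrite -lsubE mulmx_ker.
  apply/submxP; exists (rsubmx Q).
  by rewrite mul_mx_row mulmx0 mulmx1 -{1}[Q]hsubmxK HQ.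
by apply/sub_kermxP; rewrite lsubE row_mxKl.
Qed.

End SplitSubspace.

(** In the set model with n = a + b + r, this counts the k-sets that contain a given a-set and miss
    a given b-set disjoint from it. The test guards against truncated subtraction. *)
Definition shifted_bin r a k := if (a <= k)%N then 'C(r, k - a) else 0%N.

Lemma shifted_binS r a k :
  shifted_bin r.+1 a k.+1 = (shifted_bin r a k.+1 + shifted_bin r a k)%N.
Proof.
rewrite /shifted_bin; case: (leqP a k) => [ak|ka]; first by rewrite leqW // subSn // binS.
rewrite addn0; case: ifP => // ak; have -> : k.+1 = a by lia.
by rewrite subnn !bin0.
Qed.

Lemma shifted_binS0 r a : shifted_bin r.+1 a 0 = shifted_bin r a 0.
Proof. by case: a => [|a]; rewrite /shifted_bin ?subnn ?bin0. Qed.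

Section LocalLYM.
Variables (F : fieldType) (I : finType).

(* The class i is dead as soon as [r i = 0].  In the induction L starts out equal to
   J, and absorbs v i at the stage where [r i] drops from 1 to 0: from then on
   v i is killed by all the remaining generators modulo J. *)
Record lym_config n (J L : nat -> 'M[F]_(ext_dim n)) (r a b : I -> nat)
    (v : I -> 'rV[F]_(ext_dim n)) : Prop := LymConfig {
  lym_sub : forall k, (J k <= L k)%MS;
  lym_mul : forall k x, (L k *m ext_gen F n x <= J k.+1)%MS;
  lym_deg : forall k, (L k <= ext_deg F n k)%MS;
  lym_vdeg : forall i, (0 < r i)%N -> (v i <= ext_deg F n (a i))%MS;
  lym_size : forall i, (0 < r i)%N -> (a i + b i + r i)%N = n;
  lym_indep : forall k (c : I -> F),
    ((\sum_(i | (0 < r i)%N && (a i + r i == k)%N)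
        c i *: (v i *m ext_flag F n (r i)))%R <= L k)%MS ->
    forall i, (0 < r i)%N -> (a i + r i)%N = k -> c i = 0;
  lym_gen : forall i x, (0 < r i)%N -> (r i <= x)%N ->
    (v i *m ext_gen F n x <= J (a i).+1 + \sum_(y < r i) <<ext_gen F n y>>)%MS
}.

Definition merge n (M : nat -> 'M[F]_(ext_dim n)) (r a : I -> nat)
    (v : I -> 'rV[F]_(ext_dim n)) k : 'M[F]_(ext_dim n) :=
  (M k + \sum_(i | (r i == 1%N) && (a i == k)) <<v i>>)%MS.

Lemma ext_flag0 n : ext_flag F n 0 = 1%:M.
Proof. by case: n. Qed.

Lemma mul_ext_flagS n (w : 'rV[F]_(ext_dim n.+1)) r :
  w *m ext_flag F n.+1 r.+1 = row_mx 0 (lsubmx (w : 'rV_(ext_dim n + ext_dim n)) *m ext_flag F n r).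
Proof.
rewrite /= -{1}[w](@hsubmxK F 1 (ext_dim n) (ext_dim n)) mul_row_block.
by rewrite !mulmx0 !addr0.
Qed.

Lemma mul_ext_gen0 n m (w : 'M[F]_(m, ext_dim n.+1)) :
  w *m ext_gen F n.+1 0 = row_mx 0 (lsubmx (w : 'M_(m, ext_dim n + ext_dim n))).
Proof.
rewrite /= -{1}[w](@hsubmxK F m (ext_dim n) (ext_dim n)) mul_row_block.
by rewrite !mulmx0 !addr0 mulmx1.
Qed.

Lemma mul_ext_genS n m (w : 'M[F]_(m, ext_dim n.+1)) x :
  let w' : 'M_(m, ext_dim n + ext_dim n) := w in
  w *m ext_gen F n.+1 x.+1 = row_mx (lsubmx w' *m ext_gen F n x) (- (rsubmx w' *m ext_gen F n x)).
Proof.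
rewrite /= -{1}[w](@hsubmxK F m (ext_dim n) (ext_dim n)) mul_row_block.
by rewrite !mulmx0 addr0 add0r mulmxN.
Qed.

Lemma ext_deg_lsub n m (w : 'M[F]_(m, ext_dim n + ext_dim n)) k :
  (w <= ext_deg F n.+1 k)%MS -> (lsubmx w <= ext_deg F n k)%MS.
Proof.
case/submxP => D ->; rewrite /= -(@hsubmxK F m (ext_dim n) (ext_dim n) D) mul_row_block.
by rewrite !mulmx0 addr0 row_mxKl submxMl.
Qed.

Lemma ext_deg_rsub n m (w : 'M[F]_(m, ext_dim n + ext_dim n)) k :
  (w <= ext_deg F n.+1 k)%MS ->
  (rsubmx w <= (if k is k'.+1 then ext_deg F n k' else (0 : 'M_(ext_dim n))))%MS.
Proof.
case/submxP => D ->; rewrite /= -(@hsubmxK F m (ext_dim n) (ext_dim n) D) mul_row_block.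
by rewrite !mulmx0 add0r row_mxKr submxMl.
Qed.

(* One step of the induction, for the image (J', M) = (fst_image J, fst_image L) as
   well as for the fibre (J', M) = (snd_fiber J, snd_fiber L). *)
Section Step.
Variables (n : nat) (J L : nat -> 'M[F]_(ext_dim n.+1)) (r a b : I -> nat).
Variable v : I -> 'rV[F]_(ext_dim n.+1).
Hypothesis cfg : lym_config J L r a b v.
Variables J' M : nat -> 'M[F]_(ext_dim n).
Let v' i : 'rV[F]_(ext_dim n) := lsubmx (v i : 'rV_(ext_dim n + ext_dim n)).
Let r' i := (r i).-1.
Hypothesis J'M : forall k, (J' k <= M k)%MS.
Hypothesis Mgen : forall k x, (M k *m ext_gen F n x <= J' k.+1)%MS.
Hypothesis Mdeg : forall k, (M k <= ext_deg F n k)%MS.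
Hypothesis JJ' : forall k, (fst_image (J k : 'M_(_, ext_dim n + ext_dim n)) <= J' k)%MS.
Hypothesis ML : forall k, (row_mx (0 : 'M_(_, ext_dim n)) (M k) <= L k.+1)%MS.

(** Multiplication by e_0 carries M k into [L k.+1] and lengthens the flag by one, so a relation in
    dimension n lifts to one covered by [lym_indep]. *)
Lemma step_indep k (c : I -> F) :
  ((\sum_(i | (0 < r i)%N && (a i + r i == k.+1)%N) c i *: (v' i *m ext_flag F n (r' i)))%R <= M k)%MS ->
  forall i, (0 < r i)%N -> (a i + r i)%N = k.+1 -> c i = 0.
Proof.
move=> H; apply: (lym_indep cfg).
rewrite (eq_bigr (fun i => row_mx 0 (c i *: (v' i *m ext_flag F n (r' i))))); last first.
  move=> i /andP [ri _]; rewrite -{1}(prednK ri) mul_ext_flagS scale_row_mx scaler0 //.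
have -> : \sum_(i | (0 < r i)%N && (a i + r i == k.+1)%N) row_mx (0 : 'rV_(ext_dim n)) (c i *: (v' i *m ext_flag F n (r' i)))
  = row_mx 0 (\sum_(i | (0 < r i)%N && (a i + r i == k.+1)%N) c i *: (v' i *m ext_flag F n (r' i))).
  elim/big_rec2: _ => [|i y z _ ->]; first by rewrite row_mx0.
  by rewrite add_row_mx addr0.
case/submxP: H => D ->; have -> : row_mx (0 : 'rV_(ext_dim n)) (D *m M k) = D *m row_mx 0 (M k).
  by rewrite mul_mx_row mulmx0.
exact: submx_trans (submxMl _ _) (ML k).
Qed.

Lemma rank_merge k :
  (\rank (M k) + \sum_(i | (r i == 1%N) && (a i == k)) 1 <= \rank (merge M r a v' k))%N.
Proof.
apply: rank_add_indep => c H i /andP [/eqP ri /eqP ai].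
(* Where [r j] is 1 the shortened flag is empty; zero coefficients elsewhere make this an instance
   of [step_indep]. *)
pose c' j := if r j == 1%N then c j else 0.
suff : c' i = 0 by rewrite /c' ri eqxx.
apply: (@step_indep k); rewrite ?ri // ?ai ?addn1 //.
apply: submx_trans H; rewrite big_mkcond [X in (_ <= X)%MS]big_mkcond /=.
rewrite (eq_bigr (fun i => if (r i == 1%N) && (a i == k) then c i *: v' i else 0)) // => j _.
rewrite /c' /r'; case: (r j =P 1%N) => [->|_]; last by rewrite scale0r if_same.
by rewrite /= addn1 eqSS ext_flag0 mulmx1.
Qed.

Lemma lym_config_step : lym_config J' (merge M r a v') r' a b v'.
Proof.
have lsub_le m (A : 'M_(m, ext_dim n + ext_dim n)) k :
    (A <= (J k : 'M_(_, ext_dim n + ext_dim n)))%MS -> (lsubmx A <= J' k)%MS.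
  by move=> H; apply: submx_trans (JJ' k); apply: fst_image_mx.
(* Apply w -> w' to [lym_gen]: the summand of e_0 disappears, the other generators are renumbered,
   and J lands in J'. *)
have gen' i x : (0 < r i)%N -> (r i <= x.+1)%N ->
    (v' i *m ext_gen F n x <= J' (a i).+1 + \sum_(y < r' i) <<ext_gen F n y>>)%MS.
  move=> ri rx; have := lym_gen cfg ri rx.
  pose P : 'M[F]_(ext_dim n + ext_dim n, ext_dim n) := col_mx 1%:M 0.
  have lsubE m (B : 'M_(m, ext_dim n + ext_dim n)) : B *m P = lsubmx B.
    by rewrite -{1}[B]hsubmxK mul_row_col mulmx1 mulmx0 addr0.
  have -> : v' i *m ext_gen F n x = (v i *m ext_gen F n.+1 x.+1 : 'M_(_, ext_dim n + ext_dim n)) *m P.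
    by rewrite mul_ext_genS lsubE row_mxKl.
  move=> H; apply: submx_trans (submxMr P H) _.
  rewrite addsmxMr; apply: addsmxS; first by rewrite lsubE; apply: lsub_le.
  rewrite sumsmxMr_gen; apply/sumsmx_subP => -[[|y] yr] _; rewrite genmxE /=.
    rewrite (eqmxMr _ (genmxE _)) lsubE block_mxEh row_mxKl; apply/submxP; exists 0.
    by rewrite mul0mx col_mx0.
  have yr' : (y < r' i)%N by rewrite /r'; lia.
  rewrite (eqmxMr _ (genmxE _)) lsubE block_mxEh row_mxKl.
  apply: submx_trans (sumsmx_sup (Ordinal yr') _ (submx_refl _)) => //=.
  by rewrite genmxE; apply/submxP; exists (col_mx 1%:M 0); rewrite mul_col_mx mul1mx mul0mx.
split.
- by move=> k; apply: submx_trans (J'M k) (addsmxSl _ _).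
(* For an absorbed vector the sum in [gen'] is empty, so its products with all the generators lie in
   J' itself. *)
- move=> k x; rewrite addsmxMr addsmx_sub Mgen /= sumsmxMr_gen.
  apply/sumsmx_subP => i /andP [/eqP ri /eqP ai]; rewrite genmxE (eqmxMr _ (genmxE _)).
  apply: submx_trans (gen' i x _ _) _; rewrite ?ri // ai /r' ri big_ord0.
  by rewrite addsmx_sub submx_refl sub0mx.
- move=> k; rewrite addsmx_sub Mdeg /=; apply/sumsmx_subP => i /andP [/eqP ri /eqP ai].
  by rewrite genmxE -ai; apply: ext_deg_lsub; apply: (lym_vdeg cfg); rewrite ri.
- by move=> i ri'; apply: ext_deg_lsub; apply: (lym_vdeg cfg); rewrite /r' in ri'; lia.
- by move=> i ri'; have := @lym_size _ _ _ _ _ _ _ cfg i; rewrite /r' in ri' *; lia.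
- move=> k c /sub_addsmxP [[w1 w2] /= E].
  have [d Ed] : exists d : I -> F, w2 *m (\sum_(i | (r i == 1%N) && (a i == k)) <<v' i>>)%MS
      = \sum_(i | (r i == 1%N) && (a i == k)) d i *: v' i.
    have /sub_sumsmxP [u ->] := submxMl w2 (\sum_(i | (r i == 1%N) && (a i == k)) <<v' i>>)%MS.
    have D i : exists d, u i *m <<v' i>>%MS = d *: v' i.
      have /submxP [D ->] : (u i *m <<v' i>> <= v' i)%MS by rewrite (submx_trans (submxMl _ _)) ?genmxE.
      by exists (D 0 0); rewrite {1}[D]mx11_scalar mul_scalar_mx.
    have [d Hd] := fin_all_exists D.
    by exists d; apply: eq_bigr.
  (* Moving the absorbed vectors to the left turns a relation modulo the merged space into one
     modulo M. *)
  pose c' i := if r i == 1%N then - d i else c i.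
  have Hc' : forall i, (0 < r i)%N -> (a i + r i)%N = k.+1 -> c' i = 0.
    apply: step_indep.
    suff -> : \sum_(i | (0 < r i)%N && (a i + r i == k.+1)%N) c' i *: (v' i *m ext_flag F n (r' i)) = w1 *m M k.
      exact: submxMl.
    apply: (addIr (w2 *m (\sum_(i | (r i == 1%N) && (a i == k)) <<v' i>>)%MS)); rewrite -E Ed.
    rewrite [X in X + _]big_mkcond [X in _ + X]big_mkcond [RHS]big_mkcond -big_split /=.
    apply: eq_bigr => i _; rewrite /c' /r'; case: (r i) => [|[|p]] /=.
    - by rewrite addr0.
    - rewrite addn1 eqSS ext_flag0 mulmx1; case: ifP => _; rewrite ?addr0 //.
      by rewrite scaleNr addNr.
    - by rewrite addr0 addnS eqSS.
  move=> i ri' aik; have := Hc' i; rewrite /c'; case: eqP => [ri1|ri1].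
    by move: ri'; rewrite /r' ri1.
  by apply; move: ri' aik; rewrite /r'; lia.
move=> i x ri' rx; apply: gen'; rewrite /r' in ri' rx *; lia.
Qed.
End Step.

(** In positive degree the image inequality at k and the fibre inequality at k - 1 add up by
    Pascal's rule. The sum lacks one rank of the image of L on the left and one rank of the fibre of
    J on the right, and the former is at most the latter. *)
Lemma local_lym n J L r a b v : @lym_config n J L r a b v -> forall k,
  ((n - k) * \rank (L k) + \sum_(i | (0 < r i)%N) b i * shifted_bin (r i) (a i) k
     <= k.+1 * \rank (J k.+1))%N.
Proof.
elim: n J L r b v => [|n IH] J L r b v cfg k.
  rewrite sub0n mul0n big1 // => i ri.
  by have := lym_size cfg ri; lia.
pose J1 k := fst_image (J k : 'M_(_, ext_dim n + ext_dim n)).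
pose L1 k := fst_image (L k : 'M_(_, ext_dim n + ext_dim n)).
pose J2 k := snd_fiber (J k.+1 : 'M_(_, ext_dim n + ext_dim n)).
pose L2 k := snd_fiber (L k.+1 : 'M_(_, ext_dim n + ext_dim n)).
pose v' i : 'rV[F]_(ext_dim n) := lsubmx (v i : 'rV_(ext_dim n + ext_dim n)).
(* If w is in L, then e_0 ^ w' = e_0 ^ w is in J. *)
have LJ2 j : (L1 j <= J2 j)%MS.
  rewrite sub_snd_fiber.
  have [w wL ->] := fst_imageP (submx_refl (L1 j)).
  rewrite -mul_ext_gen0; apply: submx_trans (lym_mul cfg j 0).
  exact: submxMr.
have JL1 j : (J1 j <= L1 j)%MS.
  have [w wJ ->] := fst_imageP (submx_refl (J1 j)).
  by apply: fst_image_mx; apply: submx_trans wJ (lym_sub cfg j).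
have JL2 j : (J2 j <= L2 j)%MS.
  by rewrite sub_snd_fiber (submx_trans _ (lym_sub cfg j.+1)) // -sub_snd_fiber.
have LL1 j : (row_mx (0 : 'M_(_, ext_dim n)) (L1 j) <= L j.+1)%MS.
  by rewrite (submx_trans _ (lym_sub cfg j.+1)) // -sub_snd_fiber.
have cfg1 : lym_config J1 (merge L1 r a v') (fun i => (r i).-1) a b v'.
  apply: (lym_config_step cfg) => //.
  - move=> j x; have [w wL ->] := fst_imageP (submx_refl (L1 j)).
    have := fst_image_mx (submx_trans (submxMr (ext_gen F n.+1 x.+1) wL) (lym_mul cfg j x.+1)).
    by rewrite mul_ext_genS row_mxKl.
  - move=> j; have [w wL ->] := fst_imageP (submx_refl (L1 j)).
    by apply: ext_deg_lsub; apply: submx_trans wL (lym_deg cfg j).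
have L2L j : (row_mx (0 : 'M_(_, ext_dim n)) (L2 j) <= L j.+1)%MS by rewrite -sub_snd_fiber.
have cfg2 : lym_config J2 (merge L2 r a v') (fun i => (r i).-1) a b v'.
  apply: (lym_config_step cfg) => //.
  - move=> j x; rewrite sub_snd_fiber.
    have := submx_trans (submxMr (ext_gen F n.+1 x.+1) (L2L j)) (lym_mul cfg j.+1 x.+1).
    rewrite mul_ext_genS row_mxKl row_mxKr mul0mx => H.
    apply: submx_trans H; rewrite -[X in (X <= _)%MS]opprK eqmx_opp.
    by rewrite opp_row_mx oppr0.
  - move=> j; have := ext_deg_rsub (submx_trans (L2L j) (lym_deg cfg j.+1)).
    by rewrite row_mxKr.
  - by move=> j; apply: submx_trans (JL1 j) (LJ2 j).
have R1 j := rank_merge cfg LL1 j.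
have R2 j := rank_merge cfg L2L j.
have IH1 := IH _ _ _ _ _ cfg1; have IH2 := IH _ _ _ _ _ cfg2.
(* A class that dies at this step leaves the sum, but its absorbed vector adds n - j to the rank
   term. This equals [b i], because a i = j and a i + b i + 1 = n + 1. *)
have merged j : ((n - j) * \sum_(i | (r i == 1%N) && (a i == j)) 1
    + \sum_(i | (0 < (r i).-1)%N) b i * shifted_bin (r i).-1 (a i) j
    = \sum_(i | (0 < r i)%N) b i * shifted_bin (r i).-1 (a i) j)%N.
  rewrite big_distrr /= [in X in (X + _)%N]big_mkcond [in X in (_ + X)%N]big_mkcond.
  rewrite [RHS]big_mkcond -big_split /=; apply: eq_bigr => i _.
  have := @lym_size _ _ _ _ _ _ _ cfg i; rewrite /shifted_bin.
  case: (r i) => [|[|p]] //= /(_ isT) sz; rewrite bin0n muln1 addn0.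
  case: (ltngtP (a i) j) => [aj|aj|aj] //; rewrite ?muln0 //.
    by rewrite subn_eq0 leqNgt aj muln0.
  by rewrite aj subnn muln1; lia.
have IH1' j : ((n - j) * \rank (L1 j) + \sum_(i | (0 < r i)%N) b i * shifted_bin (r i).-1 (a i) j
    <= j.+1 * \rank (J1 j.+1))%N.
  apply: leq_trans (IH1 j); rewrite -merged addnA leq_add2r -mulnDr.
  by rewrite leq_mul2l R1 orbT.
have IH2' j : ((n - j) * \rank (L2 j) + \sum_(i | (0 < r i)%N) b i * shifted_bin (r i).-1 (a i) j
    <= j.+1 * \rank (J2 j.+1))%N.
  apply: leq_trans (IH2 j); rewrite -merged addnA leq_add2r -mulnDr.
  by rewrite leq_mul2l R2 orbT.
rewrite (rank_fst_snd (J k.+1 : 'M_(_, ext_dim n + ext_dim n))).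
rewrite (rank_fst_snd (L k : 'M_(_, ext_dim n + ext_dim n))).
have := mxrankS (LJ2 k); have := IH1' k.
case: k => [|k].
  (* No nonzero multiple of e_0 has degree 0, so only the image inequality enters here. *)
  have -> : snd_fiber (L 0 : 'M_(_, ext_dim n + ext_dim n)) = 0.
    apply/eqP; rewrite -submx0.
    have H : (row_mx (0 : 'M_(_, ext_dim n)) (snd_fiber (L 0 : 'M_(_, ext_dim n + ext_dim n))) <= L 0)%MS.
      by rewrite -sub_snd_fiber.
    by have := ext_deg_rsub (submx_trans H (lym_deg cfg 0)); rewrite row_mxKr.
  have -> : (\sum_(i | 0 < r i) b i * shifted_bin (r i) (a i) 0
      = \sum_(i | 0 < r i) b i * shifted_bin (r i).-1 (a i) 0)%N.
    by apply: eq_bigr => i; case: (r i) => // p _; rewrite shifted_binS0.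
  rewrite mxrank0 -/(J1 1%N) -/(J2 0%N) -/(L1 0%N) !subn0 mul1n addn0; clear; lia.
have := IH2' k.
have -> : (\sum_(i | 0 < r i) b i * shifted_bin (r i) (a i) k.+1
    = \sum_(i | 0 < r i) (b i * shifted_bin (r i).-1 (a i) k.+1
                          + b i * shifted_bin (r i).-1 (a i) k))%N.
  by apply: eq_bigr => i; case: (r i) => // p _; rewrite shifted_binS mulnDr.
rewrite big_split /= subSS.
rewrite -/(L1 k.+1) -/(L2 k) -/(J1 k.+2) -/(J2 k.+1).
have : ((n - k) * \rank (L1 k.+1) <= (n - k.+1) * \rank (L1 k.+1) + \rank (L1 k.+1))%N.
  by rewrite -mulSnr leq_mul2r; lia.
by rewrite !mulnDr !mulSn; lia.
Qed.
End LocalLYM.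

(* The probability that a uniformly random maximal chain of subsets of an n-set runs
   through a given edge from level k to level k + 1. *)
Definition chain_wt n k : rat := (((n - k) * 'C(n, k))%N%:R)^-1.

(** Deleting one element from a random chain of an (n+1)-set gives a random chain of an n-set. An
    edge of the latter comes from an edge passed either before or after the deleted element was
    added. *)
Lemma chain_wtD n k : (k < n)%N -> chain_wt n k = chain_wt n.+1 k + chain_wt n.+1 k.+1.
Proof.
case: n => [//|m]; rewrite ltnS => km; rewrite /chain_wt.
have e1 : ((m.+2 - k) * 'C(m.+2, k) = m.+2 * 'C(m.+1, k))%N by rewrite -mul_bin_down.
have e2 : ((m.+2 - k.+1) * 'C(m.+2, k.+1) = m.+2 * 'C(m.+1, k.+1))%N by rewrite -mul_bin_down.
have e3 : ((m.+1 - k) * 'C(m.+1, k) = m.+1 * 'C(m, k))%N by rewrite -mul_bin_down.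
have e4 : (k.+1 * 'C(m.+1, k.+1) = m.+1 * 'C(m, k))%N by rewrite -mul_bin_diag.
rewrite e1 e2 e3 !natrM.
have c0 : ('C(m, k)%:R : rat) != 0 by rewrite pnatr_eq0 -lt0n bin_gt0.
have m1 : (m.+1%:R : rat) != 0 by rewrite pnatr_eq0.
have m2 : (m.+2%:R : rat) != 0 by rewrite pnatr_eq0.
have k1 : (k.+1%:R : rat) != 0 by rewrite pnatr_eq0.
have mk : (m.+1%:R - k%:R : rat) != 0.
  by rewrite -natrB ?leqW // pnatr_eq0 subn_eq0 -ltnNge ltnS.
have -> : 'C(m.+1, k)%:R = m.+1%:R * 'C(m, k)%:R / (m.+1%:R - k%:R) :> rat.
  by rewrite -natrM -e3 natrM natrB ?leqW // mulrAC mulfV // mul1r.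
have -> : 'C(m.+1, k.+1)%:R = m.+1%:R * 'C(m, k)%:R / k.+1%:R :> rat.
  by rewrite -natrM -e4 natrM mulrAC mulfV // mul1r.
rewrite -[k.+1]addn1 -[m.+2]addn1 !natrD in k1 m2 *.
by field; rewrite c0 !nat1r m2 mk k1 m1.
Qed.

(** Both sides are the probability that a random order puts an a-set before a disjoint b-set:
    exactly then the chain has an edge from T to T + x with T containing the first set and missing
    the second, and x in the second, and this edge is unique. *)
Lemma sum_chain_wt a b r : (0 < b)%N ->
  \sum_(k < a + b + r) (b * shifted_bin r a k)%:R * chain_wt (a + b + r) k
    = ('C(a + b, a)%:R)^-1.
Proof.
move=> b0; elim: r => [|r IH].
  have ab : (a < a + b + 0)%N by lia.
  rewrite (bigD1 (Ordinal ab)) //= big1 ?addr0; last first.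
    move=> k nk; rewrite /shifted_bin bin0n.
    have : (k : nat) != a by apply: contraNN nk => /eqP ka; apply/eqP/val_inj.
    by case: ltngtP => //= ka _; rewrite ?muln0 ?mul0r // subn_eq0 leqNgt ka muln0 mul0r.
  rewrite /shifted_bin leqnn subnn bin0 muln1 /chain_wt addn0 addKn natrM invfM mulrA mulfV ?mul1r //.
  by rewrite pnatr_eq0 -lt0n.
rewrite -IH addnS big_ord_recl /= shifted_binS0.
rewrite (eq_bigr (fun k : 'I_(a + b + r) => (b * shifted_bin r a k.+1)%:R * chain_wt (a + b + r).+1 k.+1
  + (b * shifted_bin r a k)%:R * chain_wt (a + b + r).+1 k.+1)); last first.
  by move=> k _; rewrite /bump /= add1n shifted_binS mulnDr natrD mulrDl.
rewrite big_split /= addrA.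
rewrite -(big_ord_recl (a + b + r) (fun k : 'I_(a + b + r).+1 => (b * shifted_bin r a k)%:R * chain_wt (a + b + r).+1 k)).
rewrite big_ord_recr /= [X in _ + X + _ = _](_ : _ = 0) ?addr0; last first.
  by rewrite /shifted_bin; case: ifP => _; rewrite ?bin_small ?muln0 ?mul0r //; lia.
rewrite -big_split /=; apply: eq_bigr => k _.
by rewrite -mulrDr -chain_wtD.
Qed.

Lemma lym_total (F : fieldType) (I : finType) n J (r a b : I -> nat) v :
  @lym_config F I n J J r a b v -> (forall i, 0 < r i)%N -> (forall i, 0 < b i)%N ->
  \sum_i ('C(a i + b i, a i)%:R)^-1 <= 1 :> rat.
Proof.
move=> cfg r0 b0.
pose y k : rat := (\rank (J k))%:R / 'C(n, k)%:R.
have yn : y n <= 1.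
  rewrite /y binn divr1 lern1; apply: leq_trans (rank_ext_deg_top F n).
  by apply: mxrankS; exact: (lym_deg cfg).
have y0 : 0 <= y 0 by rewrite /y divr_ge0 ?ler0n.
(* Weighting [local_lym] by [chain_wt n k] turns its two rank terms into the densities [y k] and
   [y k.+1]. *)
have step (k : nat) : (k < n)%N ->
    \sum_i (b i * shifted_bin (r i) (a i) k)%:R * chain_wt n k <= y k.+1 - y k.
  move=> kn; rewrite -mulr_suml -natr_sum /y lerBrDr.
  have := local_lym cfg k; rewrite (eq_bigl xpredT) => [H|i]; last by rewrite r0.
  have c0 : ('C(n, k)%:R : rat) != 0 by rewrite pnatr_eq0 -lt0n bin_gt0 ltnW.
  have nk0 : ((n - k)%:R : rat) != 0 by rewrite pnatr_eq0 subn_eq0 -ltnNge.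
  have -> : (\rank (J k))%:R / 'C(n, k)%:R = ((n - k) * \rank (J k))%:R * chain_wt n k.
    by rewrite /chain_wt !natrM; field; rewrite c0 nk0.
  have -> : (\rank (J k.+1))%:R / 'C(n, k.+1)%:R = (k.+1 * \rank (J k.+1))%:R * chain_wt n k.
    rewrite /chain_wt -mul_bin_left !natrM.
    have c1 : ('C(n, k.+1)%:R : rat) != 0 by rewrite pnatr_eq0 -lt0n bin_gt0.
    have k1 : (k.+1%:R : rat) != 0 by rewrite pnatr_eq0.
    by rewrite invfM mulrA [k.+1%:R * _]mulrC mulfK.
  rewrite -mulrDl -natrD addnC ler_wpM2r ?ler_nat // /chain_wt invr_ge0 ler0n //.
have tel : \sum_(k < n) (y k.+1 - y k) = y n - y 0.
  by rewrite -(big_mkord xpredT (fun k => y k.+1 - y k)) telescope_sumr.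
apply: le_trans (_ : y n - y 0 <= 1); last by lra.
rewrite -tel; apply: le_trans (ler_sum _ (fun (k : 'I_n) _ => step k (ltn_ord k))).
rewrite exchange_big /= ler_sum // => i _.
by rewrite -(@sum_chain_wt (a i) (b i) (r i)) // (lym_size cfg).
Qed.

(** * Exterior products and the initial configuration *)

Section Wedge.
Variables (F : fieldType) (n : nat).
Notation Op := 'M[F]_(ext_dim n).

Definition ext_vec (v : 'rV[F]_n) : Op := \sum_(x < n) v 0 x *: ext_gen F n x.
Definition int_vec (f : 'cV[F]_n) : Op := \sum_(x < n) f x 0 *: int_gen F n x.

Fact ext_vec_is_linear : linear ext_vec.
Proof.
move=> c u v; rewrite /ext_vec scaler_sumr -big_split /=; apply: eq_bigr => x _.
by rewrite !mxE scalerDl scalerA.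
Qed.
HB.instance Definition _ := GRing.isLinear.Build F 'rV[F]_n Op *:%R ext_vec ext_vec_is_linear.

Lemma ext_vec_mul m (u : 'rV[F]_m) (M : 'M[F]_(m, n)) :
  ext_vec (u *m M) = \sum_p u 0 p *: ext_vec (row p M).
Proof. by rewrite mulmx_sum_row linear_sum; apply: eq_bigr => p _; rewrite linearZ. Qed.

Lemma ext_vec_delta (x : 'I_n) : ext_vec (delta_mx 0 x) = ext_gen F n x.
Proof.
rewrite /ext_vec (bigD1 x) //= big1 ?addr0 => [|y nyx]; first by rewrite mxE !eqxx scale1r.
by rewrite mxE eqxx (negPf nyx) scale0r.
Qed.

Lemma ext_gen_vec x v : ext_gen F n x *m ext_vec v = - (ext_vec v *m ext_gen F n x).
Proof.
rewrite /ext_vec mulmx_sumr mulmx_suml -sumrN; apply: eq_bigr => y _.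
by rewrite -scalemxAr -scalemxAl ext_genC scalerN ?opprK.
Qed.

Lemma ext_vec_sq v : ext_vec v *m ext_vec v = 0.
Proof.
rewrite /ext_vec; elim: (index_enum _) => [|x s IH]; first by rewrite big_nil mul0mx.
rewrite big_cons; set S := \sum_(j <- s) _ in IH *.
rewrite mulmxDl !mulmxDr IH addr0 -!(scalemxAl, scalemxAr) ext_gen_sq !scaler0 add0r.
rewrite -scalerDr (_ : _ + _ = 0) ?scaler0 //.
rewrite /S mulmx_sumr mulmx_suml -big_split big1 //= => y _.
by rewrite -scalemxAr -scalemxAl ext_genC scalerN addNr.
Qed.

Lemma ext_int_vec v f :
  ext_vec v *m int_vec f + int_vec f *m ext_vec v = ((v *m f) 0 0)%:M.
Proof.
rewrite /ext_vec mulmx_suml mulmx_sumr -big_split /= mxE raddf_sum; apply: eq_bigr => x _.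
rewrite -scalemxAl -scalemxAr -scalerDr /int_vec mulmx_suml mulmx_sumr -big_split /=.
rewrite (eq_bigr (fun y : 'I_n => f y 0 *: (x == y)%:R%:M)) => [|y _]; last first.
  by rewrite -scalemxAl -scalemxAr -scalerDr ext_int_gen.
rewrite (bigD1 x) //= big1 ?addr0 => [|y nyx].
  by rewrite eqxx scalerA scalemx1.
by rewrite eq_sym (negPf nyx) -scalemx1 scale0r scaler0.
Qed.

(** Since operators act on the right, [w *m wedge M s] is the product of the rows listed by s, in
    that order, followed by w. *)
Definition wedge k (M : 'M[F]_(k, n)) (s : seq 'I_k) : Op :=
  foldr (fun p W => W *m ext_vec (row p M)) 1%:M s.

Lemma wedge_cat k (M : 'M[F]_(k, n)) s t : wedge M (s ++ t) = wedge M t *m wedge M s.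
Proof.
elim: s => [|p s IH] /=; first by rewrite mulmx1.
by rewrite [LHS](congr1 (mulmx^~ _) IH) -mulmxA.
Qed.

Lemma wedge_map k l (M : 'M[F]_(k, n)) (N : 'M[F]_(l, n)) (f : 'I_l -> 'I_k) s :
  (forall p, row (f p) M = row p N) -> wedge M (map f s) = wedge N s.
Proof. by move=> E; elim: s => //= p s IH; rewrite [LHS](congr1 (mulmx^~ _) IH) E. Qed.

Lemma ext_gen_wedge k (M : 'M[F]_(k, n)) s x :
  ext_gen F n x *m wedge M s = (-1) ^+ size s *: (wedge M s *m ext_gen F n x).
Proof.
elim: s => [|p s IH] /=; first by rewrite scale1r mulmx1 mul1mx.
by rewrite mulmxA [X in X *m _]IH -scalemxAl -mulmxA ext_gen_vec mulmxN scalerN exprS mulN1r scaleNr mulmxA.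
Qed.

Lemma ext_vec_wedge k (M : 'M[F]_(k, n)) s v :
  ext_vec v *m wedge M s = (-1) ^+ size s *: (wedge M s *m ext_vec v).
Proof.
rewrite /ext_vec mulmx_suml mulmx_sumr scaler_sumr; apply: eq_bigr => x _.
by rewrite -scalemxAl ext_gen_wedge -scalemxAr !scalerA mulrC.
Qed.

Lemma int_vec_wedge k (M : 'M[F]_(k, n)) s f :
  {in s, forall p, row p M *m f = 0} ->
  int_vec f *m wedge M s = (-1) ^+ size s *: (wedge M s *m int_vec f).
Proof.
elim: s => [|p s IH] /= H; first by rewrite scale1r mulmx1 mul1mx.
rewrite mulmxA [X in X *m _]IH => [|q qs]; last by rewrite H // inE qs orbT.
have /eqP := ext_int_vec (row p M) f; rewrite H ?mem_head // mxE -scalemx1 scale0r addrC addr_eq0 => /eqP E.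
by rewrite -scalemxAl -mulmxA E mulmxN scalerN exprS mulN1r scaleNr mulmxA.
Qed.

Lemma wedge_vec k (M : 'M[F]_(k, n)) s v :
  wedge M s *m ext_vec v = (-1) ^+ size s *: (ext_vec v *m wedge M s).
Proof. by rewrite ext_vec_wedge signrZK. Qed.

Section Kill.
Variables (k : nat) (M : 'M[F]_(k, n)).

Lemma wedge_kill m (w : 'M_(m, ext_dim n)) s p :
  p \in s -> w *m ext_vec (row p M) = 0 -> w *m wedge M s = 0.
Proof.
move=> + w0; elim: s => //= q s IH; rewrite inE => /orP [/eqP <-|/IH w1].
  by rewrite wedge_vec -scalemxAr mulmxA w0 mul0mx scaler0.
by rewrite mulmxA w1 mul0mx.
Qed.

Lemma ext_vec_wedge_self (v : 'rV_n) :
  (v <= M)%MS -> ext_vec v *m wedge M (enum 'I_k) = 0.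
Proof.
case/submxP => u ->; rewrite ext_vec_mul mulmx_suml big1 // => p _.
rewrite -scalemxAl (@wedge_kill _ _ _ p) ?scaler0 ?mem_enum //.
exact: ext_vec_sq.
Qed.

Lemma wedge_self_ext_vec (v : 'rV_n) :
  (v <= M)%MS -> wedge M (enum 'I_k) *m ext_vec v = 0.
Proof. by move=> vM; rewrite wedge_vec ext_vec_wedge_self ?scaler0. Qed.

(** An exchange argument: v has a nonzero coefficient at some row q. Once w is multiplied by all
    other rows, v acts as a nonzero multiple of row q, so row q kills the result. *)
Lemma wedge_eq0_of_vec m (w : 'M_(m, ext_dim n)) (v : 'rV_n) :
  (v <= M)%MS -> v != 0 -> w *m ext_vec v = 0 -> w *m wedge M (enum 'I_k) = 0.
Proof.
case/submxP => u -> v0 w0.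
have [q uq] : exists q, u 0 q != 0.
  apply/existsP; apply: contraNT v0; rewrite negb_exists => /forallP u0.
  suff -> : u = 0 by rewrite mul0mx.
  by apply/rowP => q; rewrite mxE; apply/eqP; have := u0 q; rewrite negbK.
have /splitPr : q \in enum 'I_k by rewrite mem_enum.
move: (enum_uniq 'I_k) (mem_enum 'I_k) => + + spl.
case: spl => s1 s2 us ms.
have qs : q \notin s1 ++ s2.
  by move: us; rewrite (uniq_catC s1 (q :: s2)) /= mem_cat orbC -mem_cat => /andP [].
pose w' := w *m wedge M (s1 ++ s2).
have w'0 : w' *m ext_vec (u *m M) = 0.
  by rewrite /w' -mulmxA wedge_vec -scalemxAr mulmxA w0 mul0mx scaler0.
have w'q : w' *m ext_vec (row q M) = 0.
  move: w'0; rewrite ext_vec_mul mulmx_sumr (bigD1 q) //= big1 ?addr0.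
    by rewrite -scalemxAr => /eqP; rewrite scaler_eq0 (negPf uq) => /eqP.
  move=> p npq; rewrite -scalemxAr /w' -mulmxA wedge_vec -scalemxAr mulmxA.
  rewrite -mulmxA (@wedge_kill _ _ _ p) ?mulmx0 ?scaler0 ?ext_vec_sq //.
  by have := ms p; rewrite !mem_cat inE (negPf npq) /= => ->.
move: w'q; rewrite /w' !wedge_cat /= -!mulmxA wedge_vec => /eqP.
rewrite -!scalemxAr scaler_eq0 signr_eq0 => /eqP.
by rewrite !mulmxA.
Qed.

(* N provides forms dual to the rows of M; contracting with them undoes the product. *)
Lemma wedge_vac_neq0 (N : 'M[F]_(n, k)) s :
  M *m N = 1%:M -> uniq s -> ext_vac F n *m wedge M s != 0.
Proof.
move=> MN; have rc p q : row p M *m col q N = (p == q)%:R%:M.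
  apply/matrixP => x y; rewrite !ord1; have := congr1 (fun A : 'M_k => A p q) MN.
  by rewrite !mxE eqxx mulr1n => <-; apply: eq_bigr => i _; rewrite !mxE.
have vac0 f : ext_vac F n *m int_vec f = 0.
  by rewrite /int_vec mulmx_sumr big1 // => x _; rewrite -scalemxAr int_gen_vac scaler0.
elim: s => [|q s IH] /=.
  rewrite mulmx1 => _; elim: (n) => [|p IH] /=; first exact: oner_neq0.
  by rewrite row_mx_eq0 negb_and IH.
case/andP=> qs us; apply: contra (IH us) => /eqP w0.
have := ext_int_vec (row q M) (col q N); rewrite rc eqxx mxE mulr1n.
move/(congr1 (mulmx (ext_vac F n *m wedge M s))).
rewrite mulmxDr !mulmxA -[_ *m wedge M s *m ext_vec _]mulmxA w0 mul0mx add0r.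
have -> : ext_vac F n *m wedge M s *m int_vec (col q N) = 0.
  rewrite -mulmxA; have := @int_vec_wedge _ M s (col q N).
  move=> /(_ _)/(congr1 (mulmx (ext_vac F n))); rewrite -scalemxAr mulmxA vac0 mul0mx.
  move=> /(_ _)/esym/eqP; rewrite scaler_eq0 signr_eq0 => H; apply/eqP; apply: H.
  by move=> p ps; rewrite rc; case: eqP ps qs => [->->//|_ _ _]; rewrite -scalemx1 scale0r.
by rewrite mul0mx mulmx1 => <-.
Qed.
End Kill.
End Wedge.

Section InitialConfig.
Variables (F : fieldType) (n : nat).

Lemma foldr_ext_gen r : (r <= n)%N ->
  foldr (fun x W => W *m ext_gen F n x) 1%:M (iota 0 r) = ext_flag F n r.
Proof.
elim: r => [|r IH] rn; first by rewrite ext_flag0.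
rewrite ext_flagE // -{1}addn1 iotaD add0n foldr_cat /= mul1mx.
rewrite -IH; last exact: ltnW.
elim: (iota 0 r) => [|x s IHs] /=; first by rewrite mulmx1.
by rewrite [X in X *m _]IHs mulmxA.
Qed.

Lemma wedge_pid r : (r <= n)%N ->
  wedge (pid_mx r : 'M[F]_(r, n)) (enum 'I_r) = ext_flag F n r.
Proof.
move=> rn; rewrite -foldr_ext_gen // -val_enum_ord; elim: (enum 'I_r) => //= p s IH.
rewrite [X in X *m _]IH; congr (_ *m _).
rewrite -(ext_vec_delta F (widen_ord rn p)); congr (ext_vec _).
by apply/rowP => x; rewrite !mxE eqxx ltn_ord andbT -val_eqE eq_sym.
Qed.

Lemma ext_flag_wedge r k (M : 'M[F]_(k, n)) s : (r <= n)%N ->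
  exists e : nat, ext_flag F n r *m wedge M s = (-1) ^+ e *: (wedge M s *m ext_flag F n r).
Proof.
elim: r => [|r IH] rn; first by exists 0%N; rewrite ext_flag0 mul1mx mulmx1 scale1r.
have [e E] := IH (ltnW rn); rewrite ext_flagE //.
exists (e + size s)%N; rewrite -mulmxA E -scalemxAr.
rewrite [X in _ *: X = _]mulmxA ext_gen_wedge -scalemxAl scalerA.
by rewrite exprD mulmxA.
Qed.

Lemma wedge_deg k (M : 'M[F]_(k, n)) s m (w : 'M_(m, ext_dim n)) d :
  (w <= ext_deg F n d)%MS -> (w *m wedge M s <= ext_deg F n (d + size s))%MS.
Proof.
move=> wd; elim: s => [|p s IH] /=; first by rewrite mulmx1 addn0.
rewrite mulmxA /ext_vec mulmx_sumr summx_sub // => x _; rewrite -scalemxAr scalemx_sub //.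
by rewrite addnS; apply: submx_trans (submxMr _ IH) (ext_deg_gen _ _ _ _).
Qed.

Variables (I : finType) (a b r : I -> nat).
Variables (A : forall i, 'M[F]_(a i, n)) (B : forall i, 'M[F]_(b i, n)).
Hypothesis size_eq : forall i, (a i + b i + r i)%N = n.
Hypothesis r_gt0 : forall i, (0 < r i)%N.
Hypothesis flag_transversal : forall i,
  row_free (col_mx (col_mx (A i) (B i)) (pid_mx (r i) : 'M_(r i, n))).
Hypothesis cross : forall i j, i != j ->
  exists v : 'rV_n, [/\ v != 0, (v <= A i)%MS & (v <= B j)%MS].

Let v i := ext_vac F n *m wedge (A i) (enum 'I_(a i)).
Let W j := wedge (B j) (enum 'I_(b j)).
Let J k := (ext_deg F n k :&: \bigcap_j kermx (W j))%MS.

Let in_J k m (w : 'M_(m, ext_dim n)) :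
  (w <= ext_deg F n k)%MS -> (forall j, w *m W j = 0) -> (w <= J k)%MS.
Proof.
move=> wd wW; rewrite sub_capmx wd; apply/sub_bigcapmxP => j _.
by apply/sub_kermxP; rewrite wW.
Qed.

Let J_W k j : J k *m W j = 0.
Proof. by apply/sub_kermxP; apply: submx_trans (capmxSr _ _) (bigcapmx_inf j _ _). Qed.

Let r_le i : (r i <= n)%N. Proof. by rewrite -(size_eq i) leq_addl. Qed.

(** A common nonzero vector of [A i] and [B j] kills [v i], hence so does the product of the rows of
    [B j]. *)
Let vW i j : i != j -> v i *m W j = 0.
Proof.
case/cross => u [u0 uA uB]; apply: wedge_eq0_of_vec uB u0 _.
by rewrite -mulmxA wedge_self_ext_vec ?mulmx0.
Qed.

Let v_deg i : (v i <= ext_deg F n (a i))%MS.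
Proof. by have := wedge_deg (A i) (enum 'I_(a i)) (ext_vac_deg F n); rewrite size_enum_ord. Qed.

(** Up to the order of the factors, this is the product of all rows of an invertible matrix. *)
Let vW_flag i : v i *m W i *m ext_flag F n (r i) != 0.
Proof.
set M := col_mx (col_mx (A i) (B i)) (pid_mx (r i) : 'M_(r i, n)).
pose fA p : 'I_(a i + b i + r i) := lshift _ (lshift _ p).
pose fB p : 'I_(a i + b i + r i) := lshift _ (rshift _ p).
pose fE p : 'I_(a i + b i + r i) := rshift (a i + b i) p.
(* [wedge_cat] reverses the blocks, so the block applied first is listed last. *)
pose s := map fE (enum 'I_(r i)) ++ map fB (enum 'I_(b i)) ++ map fA (enum 'I_(a i)).
suff -> : v i *m W i *m ext_flag F n (r i) = ext_vac F n *m wedge M s.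
  have /row_freeP [N MN] := flag_transversal i; apply: wedge_vac_neq0 MN _.
  have uA : uniq (map fA (enum 'I_(a i))).
    by rewrite map_inj_uniq ?enum_uniq // => p q /lshift_inj/lshift_inj.
  have uB : uniq (map fB (enum 'I_(b i))).
    by rewrite map_inj_uniq ?enum_uniq // => p q /lshift_inj/rshift_inj.
  have uE : uniq (map fE (enum 'I_(r i))).
    by rewrite map_inj_uniq ?enum_uniq // => p q /rshift_inj.
  rewrite !cat_uniq uA uB uE andbT andTb; apply/andP; split.
    apply/hasPn => x; rewrite mem_cat => /orP [] /mapP [p _ ->];
    by apply/negP => /mapP [q _] /eqP; rewrite /fE /fB /fA eq_lrshift.
  apply/hasPn => x /mapP [p _ ->]; apply/negP => /mapP [q _] /eqP.
  by rewrite /fB /fA eq_lshift eq_lrshift.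
rewrite /s !wedge_cat (wedge_map (N := A i)) => [|p]; last by rewrite !rowKu.
rewrite (wedge_map (N := B i)) => [|p]; last by rewrite rowKu rowKd.
rewrite (wedge_map (N := pid_mx (r i))) => [|p]; last by rewrite rowKd.
by rewrite wedge_pid // !mulmxA.
Qed.

Lemma initial_lym_config : lym_config J J r a b v.
Proof.
have Jgen k x : (J k *m ext_gen F n x <= J k.+1)%MS.
  apply: in_J => [|j].
    by apply: submx_trans (submxMr _ (capmxSl _ _)) (ext_deg_gen _ _ _ _).
  by rewrite -mulmxA ext_gen_wedge -scalemxAr mulmxA J_W mul0mx scaler0.
split=> //.
- by move=> k; apply: capmxSl.
(* Multiplication by [W i] kills J and every [v j] with j distinct from i, which isolates the
   coefficient [c i]. *)
- move=> k c /submxP [D E] i _ aik.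
  have := congr1 (mulmx^~ (W i)) E; rewrite -mulmxA J_W mulmx0 mulmx_suml.
  rewrite (bigD1 i) /=; last by rewrite r_gt0 aik eqxx.
  rewrite big1 ?addr0 => [|j /andP [_ nji]].
    have [e Ee] := ext_flag_wedge (B i) (enum 'I_(b i)) (r_le i).
    rewrite -scalemxAl -mulmxA Ee -scalemxAr !mulmxA => /eqP.
    by rewrite !scaler_eq0 signr_eq0 (negPf (vW_flag i)) !orbF => /eqP.
  have [e Ee] := ext_flag_wedge (B i) (enum 'I_(b i)) (r_le j).
  by rewrite -scalemxAl -mulmxA Ee -scalemxAr mulmxA vW // mul0mx !scaler0.
move=> i x _ rx; have [xn|nx] := ltnP x n; last first.
  have -> : ext_gen F n x = 0.
    elim: (n) (x) nx => [|p IH] [|y] //= py; rewrite IH ?block_mx0 ?oppr0 ?block_mx0 //.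
  by rewrite mulmx0 sub0mx.
have full : row_full (col_mx (col_mx (A i) (B i)) (pid_mx (r i) : 'M_(r i, n))).
  have := flag_transversal i; rewrite /row_free /row_full => /eqP ->.
  by rewrite size_eq.
(* Decompose e_x along [A i], [B i] and the flag. The first part kills [v i], the second sends it
   into J, and the third gives the sum over the flag generators. *)
have /submxP [D] := submx_full (delta_mx 0 (Ordinal xn) : 'rV_n) full.
rewrite -[D]hsubmxK -[lsubmx D]hsubmxK !mul_row_col => E.
rewrite -(ext_vec_delta F (Ordinal xn)) E !linearD /= -mulmxA.
rewrite wedge_self_ext_vec ?submxMl // mulmx0 add0r.
apply: addmx_sub_adds.
  apply: in_J => [|j].
    rewrite /ext_vec mulmx_sumr summx_sub // => y _; rewrite -scalemxAr scalemx_sub //.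
    by apply: submx_trans (submxMr _ (v_deg i)) (ext_deg_gen _ _ _ _).
  have [<-|nij] := eqVneq i j.
    by rewrite -mulmxA ext_vec_wedge_self ?submxMl ?mulmx0.
  by rewrite -mulmxA ext_vec_wedge -scalemxAr mulmxA vW // mul0mx scaler0.
rewrite ext_vec_mul mulmx_sumr summx_sub // => p _; rewrite -scalemxAr scalemx_sub //.
apply: (sumsmx_sup p) => //; rewrite genmxE.
have -> : ext_vec (row p (pid_mx (r i) : 'M[F]_(r i, n))) = ext_gen F n p.
  rewrite -(ext_vec_delta F (widen_ord (r_le i) p)); congr (ext_vec _).
  by apply/rowP => y; rewrite !mxE eqxx ltn_ord andbT -val_eqE eq_sym.
exact: submxMl.
Qed.

End InitialConfig.

(** * Generic position *)

Definition infinite_field (F : fieldType) := forall s : seq F, exists x, x \notin s.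

Section GenericPosition.
Variables (F : fieldType) (Finf : infinite_field F).

Lemma nonroot (p : {poly F}) : p != 0 -> exists x, ~~ root p x.
Proof.
move=> p0.
have [s us ss] : exists2 s : seq F, uniq s & size s = size p.
  elim: (size p) => [|k [s us ss]]; first by exists [::].
  by have [x xs] := Finf s; exists (x :: s); rewrite /= ?xs ?ss.
case: (boolP (all (root p) s)) => [rs|/allPn [x _ nx]]; last by exists x.
by have := max_poly_roots p0 rs us; rewrite ss ltnn.
Qed.

(** Take x on the moment curve (1, t, t^2, ...): each [x *m g i] is then the value at t of a nonzero
    polynomial, and t can avoid the roots of their product. *)
Lemma avoid_kernels (I : finType) n (P : pred I) (g : I -> 'cV[F]_n) :
  (forall i, P i -> g i != 0) -> exists x : 'rV_n, forall i, P i -> x *m g i != 0.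
Proof.
move=> g0; pose p i : {poly F} := \poly_(k < n) (if insub k is Some j then g i j 0 else 0).
have p0 i : P i -> p i != 0.
  move=> Pi; apply: contraNneq (g0 i Pi) => pi0; apply/eqP/colP => j.
  have := congr1 (fun q : {poly F} => q`_j) pi0.
  by rewrite coef_poly coef0 ltn_ord valK mxE.
have : \prod_(i | P i) p i != 0 by apply/prodf_neq0.
case/nonroot => t nt; exists (\row_k t ^+ k) => i Pi.
apply: contraNneq nt => xg; rewrite /root horner_prod (bigD1 i) //= mulf_eq0.
apply/orP; left; apply/eqP; have := congr1 (fun A : 'M_1 => A 0 0) xg; rewrite !mxE => <-.
rewrite horner_poly; apply: eq_bigr => j _.
by rewrite valK !mxE mulrC.
Qed.

Lemma avoid_subspaces (I : finType) n (P : pred I) (C : I -> 'M[F]_n) :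
  (forall i, P i -> (\rank (C i) < n)%N) ->
  exists x : 'rV_n, forall i, P i -> ~~ (x <= C i)%MS.
Proof.
move=> rC; have /fin_all_exists [g Hg] : forall i, exists g : 'cV[F]_n, P i ==> (g != 0) && (C i *m g == 0).
  move=> i; case: (boolP (P i)) => [Pi|]; last by exists 0.
  have : cokermx (C i) != 0 by rewrite -mxrank_eq0 mxrank_coker subn_eq0 -ltnNge rC.
  case/matrix0Pn => x [j xj].
  exists (col j (cokermx (C i))); rewrite {2}colE mulmxA mulmx_coker mul0mx eqxx andbT.
  by apply: contraNneq xj => /colP /(_ x); rewrite !mxE => ->.
have [x Hx] := @avoid_kernels I n P g (fun i Pi => proj1 (andP (implyP (Hg i) Pi))).
exists x => i Pi; apply: contraNN (Hx i Pi) => /submxP [D ->].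
by have /andP [_ /eqP Cg] := implyP (Hg i) Pi; rewrite -mulmxA Cg mulmx0.
Qed.

(** Each new vector is chosen outside every [C i] plus the span of the earlier vectors, as long as
    that sum is proper. *)
Lemma generic_sequence (I : finType) n (C : I -> 'M[F]_n) (s : nat) :
  exists x : nat -> 'rV[F]_n, forall i s', (s' <= s)%N ->
    \rank (C i + \sum_(y < s') <<x y>>)%MS = minn n (\rank (C i) + s').
Proof.
elim: s => [|s [x Hx]].
  exists (fun _ => 0) => i [|//] _; rewrite big_ord0 addsmx0 addn0.
  by apply/esym/minn_idPr/rank_leq_col.
pose D i := (C i + \sum_(y < s) <<x y>>)%MS.
have [z Hz] := @avoid_subspaces I n (fun i => \rank (D i) < n)%N D (fun _ h => h).
exists (fun y => if (y < s)%N then x y else z) => i s' s's.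
have old t : (t <= s)%N -> (\sum_(y < t) <<if (y < s)%N then x y else z>> = \sum_(y < t) <<x y>>)%MS.
  by move=> ts; apply: eq_bigr => y _; rewrite (leq_trans (ltn_ord y) ts).
move: s's; rewrite leq_eqVlt => /orP [/eqP ->|]; last by rewrite ltnS => s's; rewrite old ?Hx.
rewrite big_ord_recr /= old // ltnn addsmxA -/(D i).
have rD : \rank (D i) = minn n (\rank (C i) + s) by apply: Hx.
case: (ltnP (\rank (D i)) n) => [lt|ge].
  have := Hz i lt; rewrite -genmxE => nz.
  have H1 : (\rank (D i) < \rank (D i + <<z>>)%MS)%N.
    rewrite ltn_neqAle mxrankS ?addsmxSl // andbT; apply: contraNN nz => /eqP H.
    have : (D i + <<z>> <= D i)%MS.
      by have [_ <-] := mxrank_leqif_sup (addsmxSl (D i) <<z>>%MS); rewrite H.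
    by apply: submx_trans; apply: addsmxSr.
  have H2 : (\rank (D i + <<z>>)%MS <= \rank (D i) + 1)%N.
    apply: leq_trans (mxrank_adds_leqif _ _) _; rewrite leq_add2l genmxE; exact: rank_leq_row.
  by move: rD lt H1 H2; clear; lia.
have H1 : (\rank (D i) <= \rank (D i + <<z>>)%MS)%N by rewrite mxrankS ?addsmxSl.
have := rank_leq_col (D i + <<z>>)%MS; move: rD ge H1; clear; lia.
Qed.

Lemma generic_basis (I : finType) n (C : I -> 'M[F]_n) :
  exists2 P : 'M[F]_n, P \in unitmx &
    forall i r, (\rank (C i) + r)%N = n -> \rank (C i + (pid_mx r : 'M_(r, n)) *m P)%MS = n.
Proof.
(* The zero subspace, added at [None], makes the generic vectors themselves a basis. *)
pose C' (o : option I) : 'M[F]_n := if o is Some i then C i else 0.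
have [x Hx] := generic_sequence C' n.
pose P : 'M[F]_n := \matrix_(k < n) x k.
have sub r : (r <= n)%N -> (\sum_(y < r) <<x y>> <= (pid_mx r : 'M_(r, n)) *m P)%MS.
  move=> rn; apply/sumsmx_subP => y _; rewrite genmxE.
  suff -> : x y = row y ((pid_mx r : 'M_(r, n)) *m P) by apply: row_sub.
  rewrite row_mul; have -> : row y (pid_mx r : 'M[F]_(r, n)) = delta_mx 0 (widen_ord rn y).
    by apply/rowP => k; rewrite !mxE eqxx ltn_ord andbT -val_eqE eq_sym.
  by rewrite -rowE rowK.
exists P.
  rewrite -row_full_unit /row_full eqn_leq rank_leq_col /=.
  have := Hx None n (leqnn n); rewrite mxrank0 add0n minnn /= => {1}<-.
  rewrite adds0mx; apply: mxrankS; have := sub n (leqnn n).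
  by rewrite pid_mx_1 mul1mx.
move=> i r Cr; have rn : (r <= n)%N by rewrite -Cr leq_addl.
apply/eqP; rewrite eqn_leq rank_leq_col /=.
have := Hx (Some i) r rn; rewrite /= Cr minnn => {1}<-.
by apply: mxrankS; apply: addsmxS (sub r rn).
Qed.

End GenericPosition.

Theorem bollobas_free (F : fieldType) (Finf : infinite_field F) (I : finType) n
    (a b : I -> nat) (A : forall i, 'M[F]_(a i, n)) (B : forall i, 'M[F]_(b i, n)) :
  (forall i, 0 < b i)%N ->
  (forall i, row_free (col_mx (A i) (B i))) ->
  (forall i j, i != j -> exists v : 'rV_n, [/\ v != 0, (v <= A i)%MS & (v <= B j)%MS]) ->
  \sum_i ('C(a i + b i, a i)%:R)^-1 <= 1 :> rat.
Proof.
move=> b0 freeAB cross.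
(* One extra dimension makes every A_i + B_i a proper subspace, so that r i > 0. *)
pose E : 'M[F]_(n, n + 1) := row_mx 1%:M 0.
have EE : E *m col_mx 1%:M 0 = 1%:M by rewrite mul_row_col mulmx1 mulmx0 addr0.
have freeE : row_free E by apply/row_freeP; exists (col_mx 1%:M 0).
have [P uP HP] := generic_basis Finf (fun i => <<col_mx (A i) (B i) *m E>>%MS).
pose r i := (n + 1 - (a i + b i))%N.
have rkC i : \rank (col_mx (A i) (B i)) = (a i + b i)%N by apply/eqP; apply: freeAB.
have szle i : (a i + b i <= n)%N by rewrite -rkC rank_leq_col.
(* In these coordinates the generic basis P becomes the standard one, so its flag is given by
   [pid_mx]. *)
pose Q := E *m invmx P.
have QQ : Q *m (P *m col_mx 1%:M 0) = 1%:M by rewrite mulmxA mulmxKV.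
have sz i : (a i + b i + r i)%N = (n + 1)%N.
  by rewrite /r subnKC // (leq_trans (szle i)) ?leq_addr.
have r0 i : (0 < r i)%N by rewrite /r subn_gt0 addn1 ltnS.
have free i : row_free (col_mx (col_mx (A i *m Q) (B i *m Q)) (pid_mx (r i) : 'M_(r i, n + 1))).
  rewrite /row_free -mul_col_mx.
  have -> : pid_mx (r i) = pid_mx (r i) *m P *m invmx P :> 'M_(r i, n + 1) by rewrite mulmxK.
  rewrite /Q mulmxA -mul_col_mx mxrankMfree ?row_free_unit ?unitmx_inv //.
  rewrite -addsmxE; have := HP i (r i); rewrite !genmxE mxrankMfree // rkC => /(_ (sz i)) H.
  rewrite sz; apply/eqP; rewrite -[RHS]H; apply/eqmx_rank/eqmxP.
  exact: adds_eqmx (eqmx_sym (genmxE _)) (eqmx_refl _).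
have crossQ i j : i != j ->
    exists v : 'rV_(n + 1), [/\ v != 0, (v <= A i *m Q)%MS & (v <= B j *m Q)%MS].
  case/cross => v [v0 vA vB]; exists (v *m Q); split; rewrite ?submxMr //.
  by apply: contraNneq v0 => vQ; rewrite -[v]mulmx1 -QQ mulmxA vQ mul0mx.
exact: lym_total (initial_lym_config sz r0 free crossQ) r0 b0.
Qed.

(** * Reductions *)

(** Both sides are the multinomial coefficient (a + b)! / (s! (a - s)! b!). *)
Lemma bin_split_pair a b s : (s <= a)%N ->
  ('C(a, s) * 'C(a + b, a) = 'C(b + s, s) * 'C(a + b, a - s))%N.
Proof.
move=> sa; apply/eqP; rewrite -(eqn_pmul2r (m := s`! * (a - s)`! * b`!)) ?muln_gt0 ?fact_gt0 //; apply/eqP.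
have e1 := bin_fact sa; have e2 := bin_fact (leq_addr b a).
have e3 := bin_fact (leq_addl b s).
have e4 : ('C(a + b, a - s) * ((a - s)`! * (b + s)`!) = (a + b)`!)%N.
  have ab : (a - s <= a + b)%N by lia.
  have sub : (a + b - (a - s) = b + s)%N by lia.
  by have := bin_fact ab; rewrite sub.
rewrite addKn in e2; rewrite addnK in e3.
move: e1 e2 e3 e4.
move: (s`!)%N ((a - s)`!)%N (b`!)%N (a`!)%N ((b + s)`!)%N ((a + b)`!)%N => x y z fa fbs fab.
move: 'C(a, s) 'C(a + b, a) 'C(b + s, s) 'C(a + b, a - s) => c1 c2 c3 c4 e1 e2 e3 e4.
transitivity fab; first by rewrite -e2 -e1; lia.
by rewrite -e4 -e3; lia.
Qed.

Section Reductions.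
Variables (F : fieldType) (Finf : infinite_field F) (I : finType).
Hypothesis two : forall i : I, exists j, j != i.

Lemma bollobas_disjoint n s (A B : I -> 'M[F]_n) :
  (forall i, \rank (A i :&: B i)%MS = 0%N) ->
  (forall i j, i != j -> (s < \rank (A i :&: B j)%MS)%N) ->
  \sum_i pair_weight 0 s (\rank (A i)) (\rank (B i)) <= 1.
Proof.
move=> disj cross.
pose D i := [set S : {set 'I_(\rank (A i))} | #|S| == s].
pose S (x : {i : I & 'I_#|D i|}) : {set 'I_(\rank (A (tag x)))} := enum_val (tagged x).
have cardS x : #|S x| = s by apply/eqP; have := enum_valP (tagged x); rewrite inE.
have cardCS x : #|~: S x| = (\rank (A (tag x)) - s)%N.
  by have := cardsC (S x); rewrite card_ord cardS => H; rewrite -[in RHS]H addKn.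
pose RA i : 'M_(\rank (A i), n) := row_base (A i).
pose A' x : 'M_(#|~: S x|, n) := rowsub (@enum_val _ (mem (~: S x))) (RA (tag x)).
pose B' x : 'M_(\rank (B (tag x)) + #|S x|, n) :=
  col_mx (row_base (B (tag x))) (rowsub (@enum_val _ (mem (S x))) (RA (tag x))).
have sA i : (s < \rank (A i))%N.
  have [j ji] := two i; apply: leq_trans (cross i j _) _; first by rewrite eq_sym.
  by rewrite mxrankS ?capmxSl.
have sB i : (s < \rank (B i))%N.
  by have [j ji] := two i; apply: leq_trans (cross j i ji) _; rewrite mxrankS ?capmxSr.
have A'row x p : p \notin S x -> (row p (RA (tag x)) <= A' x)%MS.
  move=> pS; have pS' : p \in ~: S x by rewrite inE.
  by rewrite -(enum_rankK_in pS' pS') -row_rowsub row_sub.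
have B'row x p : p \in S x -> (row p (RA (tag x)) <= B' x)%MS.
  move=> pS; apply: submx_trans (_ : rowsub (@enum_val _ (mem (S x))) (RA (tag x)) <= _)%MS.
    by rewrite -(enum_rankK_in pS pS) -row_rowsub row_sub.
  by rewrite -addsmxE addsmxSr.
have BB' x : (B (tag x) <= B' x)%MS.
  by rewrite -addsmxE (submx_trans _ (addsmxSl _ _)) // eq_row_base.
have free x : row_free (col_mx (A' x) (B' x)).
  rewrite /row_free eqn_leq rank_leq_row /=.
  have sz : (#|~: S x| + (\rank (B (tag x)) + #|S x|) = \rank (A (tag x) + B (tag x))%MS)%N.
    have := mxrank_sum_cap (A (tag x)) (B (tag x)); rewrite disj.
    by have := cardsC (S x); rewrite card_ord; lia.
  apply: leq_trans (eq_leq sz) (mxrankS _); rewrite addsmx_sub -!addsmxE; apply/andP; split; last first.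
    exact: submx_trans (BB' x) (addsmxSr _ _).
  rewrite -(eq_row_base (A (tag x))); apply/row_subP => p.
  case: (boolP (p \in S x)) => pS.
    exact: submx_trans (B'row _ _ pS) (addsmxSr _ _).
  exact: submx_trans (A'row _ _ pS) (addsmxSl _ _).
have rA' x : \rank (A' x) = (\rank (A (tag x)) - s)%N.
  rewrite -cardCS.
  have /row_freeP [N] := free x; rewrite -[N]hsubmxK mul_col_row => /(congr1 ulsubmx).
  rewrite block_mxKul => E; apply/eqP/row_freeP; exists (lsubmx N); rewrite E.
  by rewrite scalar_mx_block block_mxKul.
have cross' x y : x != y -> exists v : 'rV_n, [/\ v != 0, (v <= A' x)%MS & (v <= B' y)%MS].
  case: (eqVneq (tag x) (tag y)) => [|nt _].
    case: x y => [i k] [j l] /= ij; subst j => nkl.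
    (* Same i, distinct s-sets: a basis vector indexed by the second set but not by the first lies
       in both A' x and B' y. *)
    have nS : ~~ (enum_val l \subset enum_val k).
      apply: contraNN nkl => sub; suff /enum_val_inj -> : enum_val k = enum_val l by [].
      apply/esym/eqP; rewrite eqEcard sub.
      by rewrite (cardS (Tagged (fun i => 'I_#|D i|) l)) (cardS (Tagged (fun i => 'I_#|D i|) k)) leqnn.
    case/subsetPn: nS => p pl pk; exists (row p (RA i)); split.
    - apply: contraTneq (row_base_free (A i)) => r0; apply/negP => /row_freeP [N RN].
      have := congr1 (row p) RN; rewrite row_mul r0 mul0mx => /rowP /(_ p).
      by rewrite !mxE eqxx => /eqP; rewrite eq_sym oner_eq0.
    - exact: (A'row (Tagged (fun i => 'I_#|D i|) k)).
    - exact: (B'row (Tagged (fun i => 'I_#|D i|) l)).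
  (* Distinct indices: A' x has codimension s in [A (tag x)], so it meets a subspace of dimension
     greater than s. *)
  pose X := (A' x :&: (A (tag x) :&: B (tag y)))%MS.
  have X0 : X != 0.
    rewrite -mxrank_eq0 -lt0n.
    have := mxrank_sum_cap (A' x) (A (tag x) :&: B (tag y))%MS.
    have : (\rank (A' x + (A (tag x) :&: B (tag y)))%MS <= \rank (A (tag x)))%N.
      apply: mxrankS; rewrite addsmx_sub capmxSl andbT -(eq_row_base (A (tag x))).
      exact: rowsub_sub.
    have := cross _ _ nt; rewrite rA' -/X; have := sA (tag x).
    have key (d1 d2 d3 d4 : nat) : (s < d1 -> s < d4 -> d2 <= d1 -> d2 + d3 = d1 - s + d4 -> 0 < d3)%N.
      by lia.
    exact: key.
  exists (nz_row X); split; rewrite ?nz_row_eq0 //.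
    exact: submx_trans (nz_row_sub _) (capmxSl _ _).
  by apply: submx_trans (nz_row_sub _) (submx_trans (capmxSr _ _) (submx_trans (capmxSr _ _) (BB' y))).
have B'0 x : (0 < \rank (B (tag x)) + #|S x|)%N.
  by rewrite addn_gt0 (leq_ltn_trans _ (sB _)).
have := bollobas_free Finf B'0 free cross'.
pose w i : rat := ('C(\rank (A i) + \rank (B i), \rank (A i) - s)%:R)^-1.
rewrite (eq_bigr (fun x => w (tag x))) => [|x _]; last first.
  rewrite /w cardCS cardS; congr (_%:R^-1); congr ('C(_, _))%N.
  by rewrite [(_ + s)%N]addnC addnA subnK // ltnW.
apply: le_trans; rewrite -(@sig_big_dep _ _ _ I (fun i => 'I_#|D i|) xpredT (fun _ _ => true) (fun i _ => w i)) /=.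
(* Each i contributes one equal term per s-subset, and [bin_split_pair] identifies their total with
   the weight. *)
apply: ler_sum => i _; rewrite sumr_const cardT size_enum_ord /D card_draws card_ord.
rewrite /pair_weight muln0 !subn0 /w.
have nz : ('C(\rank (A i) + \rank (B i), \rank (A i) - s)%:R : rat) != 0.
  by rewrite pnatr_eq0 -lt0n bin_gt0 (leq_trans (leq_subr _ _)) ?leq_addr.
have nz' : ('C(\rank (A i) + \rank (B i), \rank (A i))%:R : rat) != 0.
  by rewrite pnatr_eq0 -lt0n bin_gt0 leq_addr.
rewrite -[leRHS]mulr_natl le_eqVlt; apply/orP; left; rewrite eqr_div //.
by rewrite -!natrM -(bin_split_pair _ (ltnW (sA i))).
Qed.
End Reductions.

Lemma generic_functional (F : fieldType) (Finf : infinite_field F) (I : finType) n (U : I -> 'M[F]_n) :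
  exists N : 'cV[F]_n, forall i, U i != 0 -> U i *m N != 0.
Proof.
have [x Hx] := @avoid_kernels F Finf I n (fun i => U i != 0) (fun i => (nz_row (U i))^T)
  (fun i Ui => ltac:(by rewrite trmx_eq0 nz_row_eq0)).
exists x^T => i /Hx; apply: contraNneq => UN.
have /submxP [D ->] := nz_row_sub (U i).
by rewrite -[x]trmxK -trmx_mul -mulmxA UN mulmx0 trmx0.
Qed.

Lemma rank_mul_col (F : fieldType) m n (U : 'M[F]_(m, n)) (N : 'cV[F]_n) :
  \rank (U *m N) = (U *m N != 0) :> nat.
Proof.
have [->|nz] := eqVneq (U *m N) 0; first by rewrite mxrank0.
by apply/eqP; rewrite eqn_leq rank_leq_col lt0n mxrank_eq0.
Qed.

Lemma pair_weightS t s a b : pair_weight t.+1 s a.+1 b.+1 = pair_weight t s a b.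
Proof.
rewrite /pair_weight; have -> : (a.+1 + b.+1 - 2 * t.+1 = a + b - 2 * t)%N by lia.
by rewrite !subSS.
Qed.

Lemma bollobas_infinite (F : fieldType) (Finf : infinite_field F) (I : finType)
    (two : forall i : I, exists j, j != i) n t s (A B : I -> 'M[F]_n) :
  (forall i, (\rank (A i :&: B i)%MS <= t)%N) ->
  (forall i j, i != j -> (t + s < \rank (A i :&: B j)%MS)%N) ->
  \sum_i pair_weight t s (\rank (A i)) (\rank (B i)) <= 1.
Proof.
elim: t A B => [|t IH] A B diag cross.
  apply: bollobas_disjoint => // i; first by apply/eqP; rewrite -leqn0.
(* The kernel of N cuts every [A i], every [B i] and every nonzero diagonal intersection by exactly
   one dimension. An off-diagonal intersection loses at most one, which the induction can afford. *)
have [N HN] := generic_functional Finf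
  (fun x : I + I + I => match x with inl (inl i) => A i | inl (inr i) => B i
                        | inr i => (A i :&: B i)%MS end).
pose K := kermx N.
have rK m (U : 'M_(m, n)) : \rank U = (\rank (U :&: K)%MS + (U *m N != 0)%R)%N.
  by rewrite -(mxrank_mul_ker U N) rank_mul_col addnC.
have rA i : \rank (A i) = (\rank (A i :&: K)%MS).+1.
  rewrite {1}rK (HN (inl (inl i))) ?addn1 // -mxrank_eq0 -lt0n.
  have [j ji] := two i; apply: leq_trans (_ : _ < \rank (A i :&: B j)%MS)%N _.
    by apply: leq_ltn_trans (cross i j _) => //; rewrite eq_sym.
  by rewrite mxrankS ?capmxSl.
have rB i : \rank (B i) = (\rank (B i :&: K)%MS).+1.
  rewrite {1}rK (HN (inl (inr i))) ?addn1 // -mxrank_eq0 -lt0n.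
  have [j ji] := two i; apply: leq_trans (_ : _ < \rank (A j :&: B i)%MS)%N _.
    exact: leq_ltn_trans (cross j i ji).
  by rewrite mxrankS ?capmxSr.
under eq_bigr => i _ do rewrite rA rB pair_weightS.
apply: IH => [i|i j ij].
  have sub : ((A i :&: K) :&: (B i :&: K) <= (A i :&: B i) :&: K)%MS.
    by rewrite sub_capmx capmxS ?capmxSl // (submx_trans (capmxSl _ _)) ?capmxSr.
  apply: leq_trans (mxrankS sub) _.
  have := diag i; rewrite [X in (X <= _)%N]rK; case: (eqVneq (A i :&: B i)%MS 0) => [->|nz].
    by rewrite cap0mx mxrank0.
  by rewrite (HN (inr i) nz) addn1.
have sub : ((A i :&: B j) :&: K <= (A i :&: K) :&: (B j :&: K))%MS.
  by rewrite sub_capmx !capmxS ?capmxSl ?capmxSr.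
apply: leq_trans (mxrankS sub).
have := cross i j ij; rewrite [X in (_ < X)%N]rK addSn.
by case: (_ != 0); rewrite ?addn1 ?addn0 // => /ltnW.
Qed.

(** * Arbitrary fields and finite sets *)

Lemma fraction_poly_infinite (F : fieldType) : infinite_field {fraction {poly F}}.
Proof.
move=> s; pose f (k : 'I_(size s).+1) : {fraction {poly F}} := tofrac ('X^k).
case: (boolP (all (mem s) (map f (enum 'I_(size s).+1)))) => [/allP sub|/allPn [x _ xs]]; last by exists x.
have inj : injective f.
  move=> k l /eqP; rewrite tofrac_eq => /eqP /(congr1 (fun p : {poly F} => size p)).
  by rewrite !size_polyXn => -[] /val_inj.
have := uniq_leq_size _ sub; rewrite map_inj_uniq // enum_uniq size_map size_enum_ord ltnn.
by move/(_ isT).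
Qed.

(** Extending scalars to F(X), which contains all powers of X, preserves the ranks of subspaces and
    of their intersections. *)
Lemma bollobas_mx (F : fieldType) (I : finType)
    (two : forall i : I, exists j, j != i) n t s (A B : I -> 'M[F]_n) :
  (forall i, (\rank (A i :&: B i)%MS <= t)%N) ->
  (forall i j, i != j -> (t + s < \rank (A i :&: B j)%MS)%N) ->
  \sum_i pair_weight t s (\rank (A i)) (\rank (B i)) <= 1.
Proof.
move=> diag cross; pose f : F -> {fraction {poly F}} := @tofrac _ \o polyC.
have rcap i j : \rank (map_mx f (A i) :&: map_mx f (B j))%MS = \rank (A i :&: B j)%MS.
  by rewrite -(mxrank_map f) -map_capmx.
have := @bollobas_infinite _ (@fraction_poly_infinite F) I two n t s
  (fun i => map_mx f (A i)) (fun i => map_mx f (B i)).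
under eq_bigr => i _ do rewrite !mxrank_map.
by apply=> [i|i j ij]; rewrite rcap ?diag ?cross.
Qed.

Section CoordinateSubspace.
Variables (F : fieldType) (n : nat).
Implicit Types S T : {set 'I_n}.

(** A coordinate subspace is encoded by the diagonal projection onto it, so that intersections
    become products. *)
Definition coord_mx S : 'M[F]_n := diag_mx (\row_i (i \in S)%:R).

Lemma coord_mxI S T : coord_mx S *m coord_mx T = coord_mx (S :&: T).
Proof.
rewrite mulmx_diag; congr diag_mx; apply/rowP => i.
by rewrite !mxE inE -natrM mulnb.
Qed.

Lemma rank_coord_mx S : \rank (coord_mx S) = #|S|.
Proof.
have le T : (\rank (coord_mx T) <= #|T|)%N.
  apply: leq_trans (rank_leq_row (rowsub (@enum_val _ (mem T)) (1%:M : 'M[F]_n))).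
  apply/mxrankS/row_subP => i; rewrite row_diag_mx mxE.
  case: (boolP (i \in T)) => iT; last by rewrite scale0r sub0mx.
  rewrite scale1r -row1 -(enum_rankK_in iT iT) -row_rowsub; exact: row_sub.
apply/eqP; rewrite eqn_leq le /=.
(* The projections onto S and its complement add up to the identity, so the upper bounds for both
   must be equalities. *)
have : (\rank (1%:M : 'M[F]_n) <= \rank (coord_mx S) + \rank (coord_mx (~: S)))%N.
  apply: leq_trans (mxrank_add _ _); apply: mxrankS.
  have -> : 1%:M = coord_mx S + coord_mx (~: S) :> 'M[F]_n.
    rewrite -raddfD /= -diag_const_mx; congr diag_mx; apply/rowP => i.
    by rewrite !mxE inE; case: (i \in S); rewrite ?addr0 ?add0r.
  exact: submx_refl.
rewrite mxrank1 => /leq_trans /(_ (leq_add (leqnn _) (le (~: S)))).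
by rewrite -[X in (X <= _)%N](card_ord n) -(cardsC S) leq_add2r.
Qed.

Lemma rank_cap_coord_mx S T : \rank (coord_mx S :&: coord_mx T)%MS = #|S :&: T|.
Proof.
rewrite -rank_coord_mx; apply/eqmx_rank/andP; split; last first.
  by rewrite sub_capmx {1}setIC -!coord_mxI !submxMl.
have fix_coord (w : 'M[F]_n) U : (w <= coord_mx U)%MS -> w *m coord_mx U = w.
  by case/submxP => D ->; rewrite -mulmxA coord_mxI setIid.
set X := (_ :&: _)%MS.
rewrite -[X](fix_coord _ T) ?capmxSr // -[X in X *m _](fix_coord _ S) ?capmxSl //.
by rewrite -mulmxA coord_mxI submxMl.
Qed.

End CoordinateSubspace.

Lemma card_tnth_mem (K : choiceType) (s : seq K) (X : {fset K}) :
  uniq s -> {subset X <= s} ->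
  #|[set p : 'I_(size s) | tnth (in_tuple s) p \in X]| = #|` X|.
Proof.
move=> us sub; rewrite -sum1_card (eq_bigl (fun p => tnth (in_tuple s) p \in X)) => [|p]; last first.
  by rewrite inE.
rewrite -(big_tnth _ _ s (fun x => x \in X) (fun=> 1%N)) sum1_count -size_filter.
apply/perm_size/uniq_perm; rewrite ?filter_uniq ?fset_uniq // => x.
by rewrite mem_filter; apply/andP/idP => [[]//|xX]; rewrite sub.
Qed.

Theorem mainTheorem1 (t s m : nat) (hm : (2 <= m)%N) :
  (forall (K : choiceType) (A B : 'I_m -> {fset K}),
      (forall i : 'I_m, (#|` A i `&` B i| <= t)%N) ->
      (forall i j : 'I_m, i != j -> (t + s < #|` A i `&` B j|)%N) ->
      \sum_(i < m) pair_weight t s #|` A i| #|` B i| <= 1)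
  /\
  (forall (F : fieldType) (V : vectType F) (A B : 'I_m -> {vspace V}),
      (forall i : 'I_m, (\dim (A i :&: B i)%VS <= t)%N) ->
      (forall i j : 'I_m, i != j -> (t + s < \dim (A i :&: B j)%VS)%N) ->
      \sum_(i < m) pair_weight t s (\dim (A i)) (\dim (B i)) <= 1).
Proof.
have two (i : 'I_m) : exists j, j != i.
  by case: i => [[|k] ki]; [exists (Ordinal hm) | exists (Ordinal (ltnW hm))].
split=> [K A B diag cross|F V A B diag cross].
  (* The finite ground set: its positions index the coordinates of the vector space. *)
  pose X := undup (flatten [seq (A i : seq K) ++ B i | i <- enum 'I_m]).
  have subA i : {subset A i <= X}.
    move=> x xA; rewrite mem_undup; apply/flatten_mapP; exists i; rewrite ?mem_enum //.
    by rewrite mem_cat xA.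
  have subB i : {subset B i <= X}.
    move=> x xB; rewrite mem_undup; apply/flatten_mapP; exists i; rewrite ?mem_enum //.
    by rewrite mem_cat [X in _ || X]xB orbT.
  pose S (Y : {fset K}) := [set p : 'I_(size X) | tnth (in_tuple X) p \in Y].
  have SI (Y Z : {fset K}) : S Y :&: S Z = S (Y `&` Z).
    by apply/setP => p; rewrite !inE.
  pose M (Y : {fset K}) := coord_mx rat (S Y).
  have rM Y : {subset Y <= X} -> \rank (M Y) = #|` Y|.
    by move=> YX; rewrite rank_coord_mx card_tnth_mem ?undup_uniq.
  have rMI i j : \rank (M (A i) :&: M (B j))%MS = #|` A i `&` B j|.
    rewrite rank_cap_coord_mx SI card_tnth_mem ?undup_uniq // => x.
    by rewrite inE => /andP [/subA].
  have := @bollobas_mx rat _ two _ t s (fun i => M (A i)) (fun i => M (B i)).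
  under eq_bigr => i _ do rewrite (rM _ (@subA i)) (rM _ (@subB i)).
  by apply=> [i|i j ij]; rewrite rMI ?diag ?cross.
(* A [vspace] is stored as a matrix whose rows span it, which reduces the claim to ranks. *)
have dimI i j : \dim (A i :&: B j)%VS =
    \rank (VectorInternalTheory.vs2mx (A i) :&: VectorInternalTheory.vs2mx (B j))%MS.
  by rewrite /dimv /capv VectorInternalTheory.mx2vsK.
apply: (@bollobas_mx F _ two _ t s (fun i => VectorInternalTheory.vs2mx (A i))
  (fun i => VectorInternalTheory.vs2mx (B i))) => [i|i j ij].
  by rewrite -dimI diag.
by rewrite -dimI cross.
Qed.
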